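(* Let $\mathcal{H}$ be a separable infinite-dimensional complex Hilbert space, let $T\in \mathcal{B}(\mathcal{H})$, and let $\Phi_1$ denote the maximal s.n.function. Then the following statements are equivalent. (1) $T$ is compact, i.e. $T\in\mathcal{B}_0(\mathcal{H})$. (2) $T$ is universally absolutely symmetric norming, that is, $T\in\mathcal{AN}_{\Phi^*}(\mathcal{H})$ for every s.n.function $\Phi$ equivalent to $\Phi_1$. (3) $T$ is universally symmetric norming, that is, $T\in\mathcal{N}_{\Phi^*}(\mathcal{H})$ for every s.n.function $\Phi$ equivalent to $\Phi_1$.
   Context: $\mathcal{B}(\mathcal{H})$, $\mathcal{B}_0(\mathcal{H})$, $\mathcal{B}_1(\mathcal{H})$ denote the bounded, compact, and trace class operators on $\mathcal{H}$. For $T\in\mathcal{B}(\mathcal{H})$ and $j\ge 1$, the $j$-th singular number is $s_j(T)=\inf\{\|T-F\|: F\in\mathcal{B}(\mathcal{H}),\ \operatorname{rank}F\le j-1\}$ (for compact $T$ these are the usual singular values in nonincreasing order). $c_{00}$ is the space of finitely supported real sequences and $c_{00}^*\subseteq c_{00}$ is the cone of nonincreasing nonnegative ones. A symmetric norming function (s.n.function) is a norm $\Phi:c_{00}\to[0,\infty)$ such that $\Phi((1,0,0,\dots))=1$ and $\Phi((\xi_1,\dots,\xi_n,0,\dots))=\Phi((|\xi_{j_1}|,\dots,|\xi_{j_n}|,0,\dots))$ for every $n$ and every permutation $j_1,\dots,j_n$ of $1,\dots,n$. An s.n.function is determined by its values on $c_{00}^*$. The maximal s.n.function is $\Phi_1(\xi)=\sum_j\xi_j$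 for $\xi\in c_{00}^*$. Two s.n.functions $\Phi,\Psi$ are equivalent if $\sup_{\xi\neq0}\Phi(\xi)/\Psi(\xi)<\infty$ and $\sup_{\xi\ne0}\Psi(\xi)/\Phi(\xi)<\infty$. The adjoint $\Phi^*$ of $\Phi$ is the s.n.function given by $\Phi^*(\eta)=\max\{\sum_j\eta_j\xi_j:\xi\in c_{00}^*,\ \Phi(\xi)=1\}$ for $\eta\in c_{00}^*$. Let $\Phi$ be an s.n.function equivalent to $\Phi_1$. For $K\in\mathcal{B}_1(\mathcal{H})$ put $\|K\|_\Phi=\sup_n\Phi((s_1(K),\dots,s_n(K),0,\dots))<\infty$, and for $T\in\mathcal{B}(\mathcal{H})$ put $\|T\|_{\Phi^*}=\sup_n\Phi^*((s_1(T),\dots,s_n(T),0,\dots))<\infty$. It is known that $(\mathcal{B}(\mathcal{H}),\|\cdot\|_{\Phi^*})$ is isometrically the dual of $(\mathcal{B}_1(\mathcal{H}),\|\cdot\|_\Phi)$ via the trace pairing, so $\|T\|_{\Phi^*}=\sup\{|\operatorname{Tr}(TK)|:K\in\mathcal{B}_1(\mathcal{H}),\ \|K\|_\Phi\le1\}$. $T\in\mathcal{B}(\mathcal{H})$ is $\Phi^*$-norming, written $T\in\mathcal{N}_{\Phi^*}(\mathcal{H})$, if there is $K\in\mathcal{B}_1(\mathcal{H})$ with $\|K\|_\Phi=1$ and $|\operatorname{Tr}(TK)|=\|T\|_{\Phi^*}$. $T$ is absolutely $\Phi^*$-norming, written $T\in\mathcal{AN}_{\Phi^*}(\mathcal{H})$,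 if $TP_{\mathcal{M}}\in\mathcal{N}_{\Phi^*}(\mathcal{H})$ for every nonzero closed subspace $\mathcal{M}$ of $\mathcal{H}$ (including $\mathcal{M}=\mathcal{H}$), where $P_{\mathcal{M}}$ is the orthogonal projection onto $\mathcal{M}$. *)

(* Defs.v *)
From mathcomp Require Import all_boot all_order all_algebra.
From mathcomp Require Import sesquilinear.
From mathcomp Require Import complex.
From mathcomp Require Import all_classical all_reals all_analysis.

Set Implicit Arguments.
Unset Strict Implicit.
Unset Printing Implicit Defensive.

Import Order.TTheory GRing.Theory Num.Theory.
Import numFieldNormedType.Exports.

Local Open Scope classical_set_scope.
Local Open Scope complex_scope.
Local Open Scope ring_scope.

Section SymmetricNormingFunctions.
Variable R : realType.
Implicit Types (xi eta : R ^nat) (Phi Psi : R ^nat -> R).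

Definition c00 : set (R ^nat) :=
  [set xi | exists n, forall k, (n <= k)%N -> xi k = 0].

Definition c00_star : set (R ^nat) :=
  [set xi | [/\ c00 xi, nonincreasing_seq xi & forall k, 0 <= xi k]].

(* Only the values of Phi on c00 are constrained, and only those are used.
   For s : seq R, nth 0 s is the sequence (s_1, ..., s_n, 0, 0, ...). *)
Record snfunction Phi : Prop := SNFunction {
  snf_ge0 : forall xi, c00 xi -> 0 <= Phi xi ;
  snf_eq0 : forall xi, c00 xi -> Phi xi = 0 -> xi = (fun=> 0) ;
  snfZ : forall (a : R) xi, c00 xi ->
    Phi (fun k => a * xi k) = `|a| * Phi xi ;
  snfD : forall xi eta, c00 xi -> c00 eta ->
    Phi (fun k => xi k + eta k) <= Phi xi + Phi eta ;
  snf1 : Phi (nth 0 [:: 1]) = 1 ;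
  snf_sym : forall s t : seq R, perm_eq t [seq `|x| | x <- s] ->
    Phi (nth 0 s) = Phi (nth 0 t) }.

(* The absolute values give the symmetric extension to all of c00. *)
Definition snf_max : R ^nat -> R := fun xi => \sum_(k \in [set: nat]) `|xi k|.

Definition snf_equiv Phi Psi : Prop :=
  let nonzero := [set xi | c00 xi /\ xi <> (fun=> 0)] in
  has_ubound [set Phi xi / Psi xi | xi in nonzero] /\
  has_ubound [set Psi xi / Phi xi | xi in nonzero].

(* Meaningful for eta in c00_star only, which determines the adjoint; every
   use below is at such an eta. *)
Definition snf_adjoint Phi : R ^nat -> R := fun eta =>
  sup [set \sum_(k \in [set: nat]) eta k * xi k
      | xi in [set xi | c00_star xi /\ Phi xi = 1]].

End SymmetricNormingFunctions.

Section Operators.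
Variables (R : realType) (H : completeNormedModType R[i]).
Implicit Types (T K F A : H -> H) (M : set H) (Phi : R ^nat -> R).

Definition separable_space : Prop :=
  exists D : set H, countable D /\ dense D.

(* V is contained in the span of n vectors. *)
Definition dim_le (n : nat) (V : set H) : Prop :=
  exists v : 'I_n -> H, forall x, V x ->
    exists a : 'I_n -> R[i], x = \sum_(i < n) a i *: v i.

Definition infinite_dimensional : Prop := forall n, ~ dim_le n [set: H].

Definition bounded_operator T : Prop := linear T /\ continuous T.

Definition compact_operator T : Prop :=
  bounded_operator T /\ compact (closure (T @` [set x | `|x| <= 1])).

(* The norm of H takes its values in R[i]; Re brings it back to R. *)
Definition opnorm T : R :=
  sup [set complex.Re `|T x| | x in [set x : H | `|x| <= 1]].

(* Indexed from 0: snum T j is the (j+1)-st singular number. *)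
Definition snum T : R ^nat := fun j =>
  inf [set opnorm (T \- F)
      | F in [set F | bounded_operator F /\ dim_le j (range F)]].

(* Summability forces snum K j --> 0, hence compactness. *)
Definition trace_class K : Prop :=
  bounded_operator K /\ cvgn (series (snum K)).

Definition snf_norm Phi T : R :=
  sup (range (fun n : nat => Phi (nth 0 (mkseq (snum T) n)))).

Definition closed_subspace M : Prop :=
  [/\ closed M, M 0 &
      forall (a : R[i]) x y, M x -> M y -> M (a *: x + y)].

Variable dot : {dot H for Num.conj}.

Definition orthonormal_basis (e : nat -> H) : Prop :=
  (forall i j, dot (e i) (e j) = (i == j)%:R) /\
  (forall x, (fun n => \sum_(0 <= k < n) dot x (e k) *: e k) @ \oo --> x).

(* The casts to numFieldType give access to the norm topology of R[i]. For A
   trace class the sum does not depend on the basis, and orthonormal bases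
   indexed by nat exist when H is separable and infinite dimensional. *)
Definition has_trace A (t : (R[i] : numFieldType)) : Prop :=
  forall e, orthonormal_basis e ->
    (fun n => \sum_(0 <= k < n) dot (A (e k)) (e k) : (R[i] : numFieldType))
      @ \oo --> t.

Definition trace A : R[i] := get (has_trace A).

Definition proj M : H -> H := fun x =>
  get [set y | M y /\ forall z, M z -> dot (x - y) z = 0].

Definition adj_norming Phi T : Prop :=
  exists K, [/\ trace_class K, snf_norm Phi K = 1 &
    `|trace (T \o K)| = (snf_norm (snf_adjoint Phi) T)%:C].

Definition abs_adj_norming Phi T : Prop :=
  forall M, closed_subspace M -> M <> [set 0] ->
    adj_norming Phi (T \o proj M).

End Operators.

(* Main.v *)
(* For T compact, iterating norm maximisation on orthogonal complements gives a
   Schmidt expansion T = \sum_j s_j <., e_j> f_j. Near-maximisers of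
   \sum_j s_j xi_j over the unit sphere of Phi are bounded in l^1, hence have a
   pointwise cluster point xi; as s tends to 0 nothing is lost in the limit, and
   K = \sum_j xi_j <., f_j> e_j norms T. Compactness passes to T P_M.

   If T is not compact its singular numbers stay above some d > 0. Let Phi be the
   Lorentz norm with weights w_j = (s_j + 2^-j) / alpha, alpha = s_0 + 1, which is
   equivalent to Phi_1. Testing on indicators of {0, ..., n-1} gives
   ||T||_{Phi^*} >= alpha, since the partial sums of s grow linearly. But for
   ||K||_Phi = 1 with singular numbers k_j, the Ky Fan inequality and Abel
   summation give |Tr(TK)| <= \sum_j s_j k_j <= alpha - k_0 < alpha. *)
Require Import Defs.
From mathcomp Require Import all_boot all_order all_algebra.
From mathcomp Require Import sesquilinear complex.
From mathcomp Require Import all_classical all_reals all_analysis.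
From mathcomp Require Import lra ring.

Set Implicit Arguments.
Unset Strict Implicit.
Unset Printing Implicit Defensive.

Import Order.TTheory GRing.Theory Num.Theory.
Import numFieldNormedType.Exports.

Local Open Scope classical_set_scope.
Local Open Scope complex_scope.
Local Open Scope ring_scope.

(** * Real-valued norms and inner products *)

(** The summand [2^-j] in the weights is what keeps the norm from being attained. With weights
    [s_j / s_0] the same estimates would give the bound [s_0], but equality would not be excluded.
    The summand gains at least [k_0] in the upper estimate; being summable, it changes the sums over
    indicators by at most 2, which is negligible against linear growth. The constant [alpha] makes
    [w_0 = 1], and non-compactness enters through [w_j >= d / alpha], which makes the Lorentz norm
    equivalent to the maximal one. Three obstacles shape the rest. A maximising sequence may have
    infinite support, so its norm is controlled through truncations only. The trace is taken in an
    arbitrary orthonormal basis, while the estimates live on the Schmidt vectors of [K]. A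
    non-compact [T] has no Schmidt expansion, so the Ky Fan inequality is proved on finite rank
    compressions of [T]. *)

Lemma eventually_inv_lt (R : realType) (r : R) : 0 < r ->
  exists N, forall n, (N <= n)%N -> n.+1%:R^-1 < r.
Proof.
move=> r0; have [N hN] : exists N : nat, r^-1 < N%:R.
  by exists (Num.bound r^-1); rewrite archi_boundP // invr_ge0 ltW.
exists N => n Nn; rewrite -[ltRHS]invrK ltf_pV2 ?posrE ?invr_gt0 //.
by apply: (lt_le_trans hN); rewrite ler_nat (leq_trans Nn).
Qed.

Section RealNorm.
Variables (R : realType) (V : normedZmodType R[i]).
Implicit Types x y : V.

(** The order of [R[i]] is only partial; a norm with values in [R] gives access to total order,
    suprema and [lra]. *)
Definition nrm x : R := complex.Re `|x|.

Lemma nrmE x : `|x| = (nrm x)%:C.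
Proof. by rewrite /nrm RRe_real // ger0_real. Qed.

Lemma nrm_ge0 x : 0 <= nrm x.
Proof. by rewrite -lecR -nrmE /= normr_ge0. Qed.

Lemma nrm0 : nrm 0 = 0.
Proof. by rewrite /nrm normr0. Qed.

Lemma nrm_eq0 x : nrm x = 0 -> x = 0.
Proof. by move=> x0; apply/eqP; rewrite -normr_eq0 nrmE x0. Qed.

Lemma nrmN x : nrm (- x) = nrm x.
Proof. by rewrite /nrm normrN. Qed.

Lemma nrm_sub x y : nrm (x - y) = nrm (y - x).
Proof. by rewrite /nrm distrC. Qed.

Lemma nrmD x y : nrm (x + y) <= nrm x + nrm y.
Proof. by rewrite -lecR rmorphD /= -!nrmE ler_normD. Qed.

Lemma nrmB_le x y z : nrm (x - z) <= nrm (x - y) + nrm (y - z).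
Proof. by rewrite -[x - z](subrKA y) nrmD. Qed.

Lemma nrm_triangle x y : nrm x <= nrm y + nrm (x - y).
Proof. by rewrite -{1}[x](subrK y) addrC nrmD. Qed.

Lemma nrm_sum (I : Type) (r : seq I) (P : pred I) (F : I -> V) :
  nrm (\sum_(i <- r | P i) F i) <= \sum_(i <- r | P i) nrm (F i).
Proof.
elim/big_rec2 : _ => [|i y x _ xy]; first by rewrite nrm0.
by apply: (le_trans (nrmD _ _)); rewrite lerD2l.
Qed.

End RealNorm.

Lemma nrmDD (R : realType) (V : normedZmodType R[i]) (x : V) :
  nrm (x + x) = 2 * nrm x.
Proof.
by apply: complexI; rewrite -mulr2n -nrmE normrMn nrmE -rmorphMn /= mulr_natl.
Qed.

Section Scalars.
Variable R : realType.
Implicit Types (a b : R[i]) (r : R).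

Lemma nrmM a b : nrm (a * b) = nrm a * nrm b.
Proof. by apply: complexI; rewrite rmorphM /= -!nrmE normrM. Qed.

Lemma nrm_real r : nrm r%:C = `|r|.
Proof. by rewrite /nrm normc_def /= expr0n addr0 sqrtr_sqr. Qed.

Lemma nrm_conj a : nrm (Num.conj a) = nrm a.
Proof. by rewrite /nrm norm_conjC. Qed.

Lemma ReD a b : complex.Re (a + b) = complex.Re a + complex.Re b.
Proof. by case: a; case: b. Qed.

Lemma ReN a : complex.Re (- a) = - complex.Re a.
Proof. by case: a. Qed.

Lemma ReB a b : complex.Re (a - b) = complex.Re a - complex.Re b.
Proof. by rewrite ReD ReN. Qed.

Lemma ReZ r a : complex.Re (r%:C * a) = r * complex.Re a.
Proof. by case: a => x y /=; rewrite mul0r subr0. Qed.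

Lemma Re_conj a : complex.Re (Num.conj a) = complex.Re a.
Proof.
have /= := ReJ_add a; rewrite -[conjc a]/(Num.conj a) => h.
have := ReJ_add (Num.conj a); rewrite -[conjc _]/(Num.conj _) conjCK addrC -h.
exact: complexI.
Qed.

Lemma conj_real r : Num.conj r%:C = r%:C :> R[i].
Proof. by apply/CrealP; apply/complex_realP; exists r. Qed.

Lemma mul_conjE a : a * Num.conj a = (nrm a ^+ 2)%:C.
Proof. by rewrite -normCK nrmE rmorphXn. Qed.

Lemma Re_le_nrm a : complex.Re a <= nrm a.
Proof.
rewrite /nrm normc_def /=; case: a => x y /=.
by apply: (le_trans (ler_norm _)); rewrite -sqrtr_sqr ler_wsqrtr // lerDl sqr_ge0.
Qed.

Lemma Im_le_nrm a : complex.Im a <= nrm a.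
Proof.
rewrite /nrm normc_def /=; case: a => x y /=.
by apply: (le_trans (ler_norm _)); rewrite -sqrtr_sqr ler_wsqrtr // lerDr sqr_ge0.
Qed.

End Scalars.

Section NormedModule.
Variables (R : realType) (V : normedModType R[i]).
Implicit Types (x y : V) (a : R[i]).

Lemma nrmZ a x : nrm (a *: x) = nrm a * nrm x.
Proof. by apply: complexI; rewrite rmorphM /= -!nrmE normrZ. Qed.

Lemma nrmZr (r : R) x : nrm (r%:C *: x) = `|r| * nrm x.
Proof. by rewrite nrmZ nrm_real. Qed.

Lemma gt0_complexP (e : R[i]) : 0 < e -> exists2 r : R, 0 < r & e = r%:C.
Proof.
move=> e0; exists (complex.Re e); last by rewrite RRe_real // gtr0_real.
by rewrite -ltcR RRe_real // gtr0_real.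
Qed.

Lemma cvg_nrmP (T : Type) (F : set_system T) (FF : Filter F) (u : T -> V) x :
  (u @ F --> x) <-> (forall e : R, 0 < e -> \forall t \near F, nrm (u t - x) < e).
Proof.
split=> [/cvgrPdist_lt h e e0|h].
  have := h e%:C; rewrite ltcR => /(_ e0); apply: filterS => t.
  by rewrite nrmE ltcR nrm_sub.
apply/cvgrPdist_lt => e /gt0_complexP [r r0 ->].
by apply: filterS (h r r0) => t; rewrite nrmE ltcR nrm_sub.
Qed.

Lemma cvg_seqP (u : nat -> V) x :
  (u @ \oo --> x) <->
  (forall e : R, 0 < e -> exists N, forall n, (N <= n)%N -> nrm (u n - x) < e).
Proof.
rewrite cvg_nrmP; split=> h e /h.
  by case=> N _ hN; exists N.
by case=> N hN; exists N.
Qed.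

Lemma nrm_cvg_le (u : nat -> V) x (C : R) (N : nat) :
  u @ \oo --> x -> (forall n, (N <= n)%N -> nrm (u n) <= C) -> nrm x <= C.
Proof.
move=> /cvg_seqP ux uC; apply/ler_addgt0Pr => e /ux [M hM].
have /ltW h := hM _ (leq_maxr N M); have hu := uC _ (leq_maxl N M).
apply: (le_trans (nrm_triangle x (u (maxn N M)))).
by rewrite nrm_sub lerD.
Qed.

End NormedModule.

Lemma cauchy_seq_cvg (R : realType) (V : completeNormedModType R[i])
    (u : nat -> V) :
  (forall e : R, 0 < e -> exists N, forall n m, (N <= n)%N -> (N <= m)%N ->
     nrm (u n - u m) < e) -> exists x : V, u @ \oo --> x.
Proof.
move=> h; suff : cvg (u @ \oo) by move=> uc; exists (lim (u @ \oo)).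
apply/cauchy_cvgP/cauchy_exP => e /gt0_complexP [r r0 ->].
have [N hN] := h r r0; exists (u N); exists N => // n /= Nn.
by rewrite -ball_normE /ball_ /= nrmE ltcR hN.
Qed.

Section InnerProduct.
Variables (R : realType) (H : completeNormedModType R[i]).
Variable dot : {dot H for Num.conj}.
Hypothesis norm_dot : forall x : H, `|x| ^+ 2 = dot x x.
Implicit Types (x y z : H) (a : R[i]).

Lemma dotC x y : dot x y = Num.conj (dot y x).
Proof. by rewrite hermC expr0 mul1r. Qed.

Lemma dotDl x y z : dot (x + y) z = dot x z + dot y z.
Proof. exact: linearDl. Qed.

Lemma dotZl a x z : dot (a *: x) z = a * dot x z.
Proof. by rewrite linearZl_LR. Qed.

Lemma dotDr x y z : dot z (x + y) = dot z x + dot z y.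
Proof. by rewrite dotC dotDl rmorphD /= -!dotC. Qed.

Lemma dotZr a x z : dot z (a *: x) = Num.conj a * dot z x.
Proof. by rewrite dotC dotZl rmorphM /= -dotC. Qed.

Lemma dot0l x : dot 0 x = 0.
Proof. by rewrite -[X in dot X](scale0r (0 : H)) dotZl mul0r. Qed.

Lemma dot0r x : dot x 0 = 0.
Proof. by rewrite dotC dot0l rmorph0. Qed.

Lemma dotNl x y : dot (- x) y = - dot x y.
Proof. by rewrite -scaleN1r dotZl mulN1r. Qed.

Lemma dotNr x y : dot x (- y) = - dot x y.
Proof. by rewrite dotC dotNl rmorphN /= -dotC. Qed.

Lemma dotBl x y z : dot (x - y) z = dot x z - dot y z.
Proof. by rewrite dotDl dotNl. Qed.

Lemma dotBr x y z : dot z (x - y) = dot z x - dot z y.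
Proof. by rewrite dotDr dotNr. Qed.

Lemma dot_suml I (r : seq I) (P : pred I) (F : I -> H) y :
  dot (\sum_(i <- r | P i) F i) y = \sum_(i <- r | P i) dot (F i) y.
Proof.
by apply: (big_morph (fun x => dot x y)); [move=> *; exact: dotDl|exact: dot0l].
Qed.

Lemma dot_sumr I (r : seq I) (P : pred I) (F : I -> H) y :
  dot y (\sum_(i <- r | P i) F i) = \sum_(i <- r | P i) dot y (F i).
Proof.
by apply: (big_morph (fun x => dot y x)); [move=> *; exact: dotDr|exact: dot0r].
Qed.

Lemma dotxx x : dot x x = (nrm x ^+ 2)%:C.
Proof. by rewrite -norm_dot nrmE rmorphXn. Qed.

Lemma nrm_sq x : nrm x ^+ 2 = complex.Re (dot x x).
Proof. by rewrite dotxx. Qed.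

Lemma nrmB_sq x y :
  nrm (x - y) ^+ 2 = nrm x ^+ 2 - 2 * complex.Re (dot x y) + nrm y ^+ 2.
Proof.
rewrite !nrm_sq dotBl !dotBr (dotC y x) !ReB Re_conj; lra.
Qed.

Lemma nrmD_sq x y :
  nrm (x + y) ^+ 2 = nrm x ^+ 2 + 2 * complex.Re (dot x y) + nrm y ^+ 2.
Proof. by rewrite -{1}[y]opprK nrmB_sq dotNr ReN nrmN; lra. Qed.

Lemma parallelogram x y :
  nrm (x + y) ^+ 2 + nrm (x - y) ^+ 2 = 2 * nrm x ^+ 2 + 2 * nrm y ^+ 2.
Proof. by rewrite nrmD_sq nrmB_sq; lra. Qed.

Lemma pythagoras x y : dot x y = 0 ->
  nrm (x + y) ^+ 2 = nrm x ^+ 2 + nrm y ^+ 2.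
Proof. by move=> h; rewrite nrmD_sq h /=; lra. Qed.

Lemma nrm_le_sq (r : R) x : 0 <= r -> nrm x ^+ 2 <= r ^+ 2 -> nrm x <= r.
Proof. by move=> r0; rewrite ler_pXn2r // nnegrE // nrm_ge0. Qed.

Lemma cauchy_schwarz x y : nrm (dot x y) <= nrm x * nrm y.
Proof.
have [y0|y0] := eqVneq (nrm y) 0.
  by rewrite (nrm_eq0 y0) dot0r !nrm0 mulr0.
have yp : 0 < nrm y by rewrite lt0r y0 nrm_ge0.
pose d := dot x y.
(* With this coefficient [a *: y] is the orthogonal projection of [x] on the line of [y], so that
   the squared length of [x - a *: y] is the defect in the inequality, divided by [nrm y ^+ 2]. *)
pose a : R[i] := ((nrm y ^+ 2)^-1)%:C * d.
have := sqr_ge0 (nrm (x - a *: y)).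
rewrite nrmB_sq dotZr nrmZ -/d /a rmorphM /= conj_real -mulrA.
rewrite (mulrC (Num.conj d)) mul_conjE ReZ /= nrmM nrm_real ger0_norm; last first.
  by rewrite invr_ge0 sqr_ge0.
move=> h.
rewrite -(@ler_pXn2r _ 2) ?nnegrE ?mulr_ge0 ?nrm_ge0 // exprMn.
have -> : nrm x ^+ 2 * nrm y ^+ 2 = nrm d ^+ 2 + nrm y ^+ 2 *
   (nrm x ^+ 2 - 2 * ((nrm y ^+ 2)^-1 * nrm d ^+ 2) +
      ((nrm y ^+ 2)^-1 * nrm d * nrm y) ^+ 2) by field.
by rewrite lerDl mulr_ge0 // sqr_ge0.
Qed.

Lemma cvg_dotl (u : nat -> H) x y : u @ \oo --> x ->
  (fun n => dot (u n) y : (R[i] : numFieldType)) @ \oo --> dot x y.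
Proof.
move=> /cvg_seqP ux; apply/(@cvg_seqP R (R[i] : numFieldType)) => e e0.
have y1 : 0 < nrm y + 1 by rewrite ltr_wpDl // nrm_ge0.
have [N hN] := ux (e / (nrm y + 1)) (divr_gt0 e0 y1).
exists N => n /hN h; rewrite -dotBl.
apply: (le_lt_trans (cauchy_schwarz _ _)).
apply: (@le_lt_trans _ _ (nrm (u n - x) * (nrm y + 1))).
  by rewrite ler_wpM2l ?nrm_ge0 // lerDl.
by rewrite -ltr_pdivlMr.
Qed.

End InnerProduct.

(** * Orthogonal systems and Gram-Schmidt *)

Lemma finite_cauchy_schwarz (R : realType) n (a b : nat -> R) (A B : R) :
  0 <= A -> 0 <= B ->
  \sum_(k < n) a k ^+ 2 <= A ^+ 2 -> \sum_(k < n) b k ^+ 2 <= B ^+ 2 ->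
  \sum_(k < n) a k * b k <= A * B.
Proof.
move=> A0 B0 hA hB.
have zero (c : nat -> R) : \sum_(k < n) c k ^+ 2 <= 0 -> forall k : 'I_n, c k = 0.
  move=> c0 k; apply/eqP; rewrite -sqrf_eq0 eq_le sqr_ge0 andbT.
  apply: le_trans c0; rewrite (bigD1 k) //= lerDl sumr_ge0 // => i _.
  exact: sqr_ge0.
have [Az|An] := eqVneq A 0.
  rewrite big1 ?Az ?mul0r // => k _.
  by rewrite zero ?mul0r // (le_trans hA) // Az expr0n.
have [Bz|Bn] := eqVneq B 0.
  rewrite big1 ?Bz ?mulr0 // => k _.
  by rewrite (zero b) ?mulr0 // (le_trans hB) // Bz expr0n.
have Ap : 0 < A by rewrite lt0r An.
have Bp : 0 < B by rewrite lt0r Bn.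
(* This weight balances the two halves of [a b <= t/2 a^2 + b^2/(2t)]: after summation each
   contributes [A * B / 2]. *)
pose t := B / A; have tp : 0 < t by rewrite divr_gt0.
apply: (@le_trans _ _ (\sum_(k < n) (t / 2 * a k ^+ 2 + t^-1 / 2 * b k ^+ 2))).
  apply: ler_sum => k _.
  have := sqr_ge0 (t * a k - b k) => h.
  have : 0 <= (t * a k - b k) ^+ 2 / t / 2 by rewrite !divr_ge0 // ltW.
  have -> : (t * a k - b k) ^+ 2 / t / 2 =
    t / 2 * a k ^+ 2 + t^-1 / 2 * b k ^+ 2 - a k * b k by field; exact: lt0r_neq0.
  by rewrite subr_ge0.
rewrite big_split /= -!mulr_sumr.
apply: (@le_trans _ _ (t / 2 * A ^+ 2 + t^-1 / 2 * B ^+ 2)).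
  by rewrite lerD // ler_wpM2l // ?divr_ge0 ?invr_ge0 // ltW.
by rewrite le_eqVlt; apply/orP; left; apply/eqP; rewrite /t; field; rewrite An Bn.
Qed.

(** Dependent choice in which each term sees all earlier ones. It drives Gram-Schmidt, the
    orthonormal basis and the Schmidt vectors. *)
Lemma prefix_choice (T : Type) (P : seq T -> T -> Prop) :
  (forall s, exists x, P s x) ->
  exists u : nat -> T, forall n, P (mkseq u n) (u n).
Proof.
move=> /choice [g hg].
pose pre := fix pre n := if n is n'.+1 then rcons (pre n') (g (pre n')) else [::].
exists (g \o pre) => n.
suff -> : mkseq (g \o pre) n = pre n by exact: hg.
by elim: n => [//|n IH]; rewrite mkseqS IH.
Qed.

Section OrthogonalSystems.
Variables (R : realType) (H : completeNormedModType R[i]).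
Variable dot : {dot H for Num.conj}.
Hypothesis norm_dot : forall x : H, `|x| ^+ 2 = dot x x.
Implicit Types (x y z : H) (a : R[i]) (e : nat -> H).

(* Zero vectors are allowed, so that Schmidt expansions of operators of finite
   rank need no separate treatment. *)
Definition orthosys n e : Prop :=
  (forall i j, (i < n)%N -> (j < n)%N -> i <> j -> dot (e i) (e j) = 0) /\
  (forall i, (i < n)%N -> e i = 0 \/ nrm (e i) = 1).

(** For an orthosystem this is the orthogonal projection on the span of the first [n] vectors, and
    membership in that span is expressed below as [fourier e n y = y]. *)
Definition fourier e n x : H := \sum_(k < n) dot x (e k) *: e k.

Lemma orthosysS n e : orthosys n e ->
  (forall j, (j < n)%N -> dot (e n) (e j) = 0) -> (e n = 0 \/ nrm (e n) = 1) ->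
  orthosys n.+1 e.
Proof.
move=> [h1 h2] h3 h4; split=> [i j|i]; last first.
  by rewrite ltnS leq_eqVlt => /predU1P[->|/h2].
rewrite ltnS leq_eqVlt => /predU1P[->|ltin];
  rewrite ltnS leq_eqVlt => /predU1P[->|ltjn] // ij.
- exact: h3.
- by rewrite dotC h3 // rmorph0.
- exact: h1.
Qed.

Lemma fourierD e n x y : fourier e n (x + y) = fourier e n x + fourier e n y.
Proof. by rewrite -big_split; apply: eq_bigr => k _; rewrite dotDl scalerDl. Qed.

Lemma fourierZ e n a x : fourier e n (a *: x) = a *: fourier e n x.
Proof. by rewrite scaler_sumr; apply: eq_bigr => k _; rewrite dotZl scalerA. Qed.

Lemma fourierB e n x y : fourier e n (x - y) = fourier e n x - fourier e n y.
Proof. by rewrite -scaleN1r fourierD fourierZ scaleN1r. Qed.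

Lemma fourier_sum e n I (r : seq I) (P : pred I) (F : I -> H) :
  fourier e n (\sum_(i <- r | P i) F i) = \sum_(i <- r | P i) fourier e n (F i).
Proof.
apply: (big_morph (fourier e n)); first exact: fourierD.
by rewrite -[X in fourier e n X](scale0r (0 : H)) fourierZ scale0r.
Qed.

Section System.
Variables (e : nat -> H) (n : nat).
Hypothesis oe : orthosys n e.

Lemma orthosys_le1 i : (i < n)%N -> nrm (e i) <= 1.
Proof. by move=> /oe.2 [->|->//]; rewrite nrm0. Qed.

Lemma dot_fourier x j : (j < n)%N -> dot (fourier e n x) (e j) = dot x (e j).
Proof.
move=> jn; rewrite dot_suml (bigD1 (Ordinal jn)) //= big1 ?addr0.
  rewrite dotZl dotxx //.
  by have [->|->] := oe.2 j jn; [rewrite dot0r mul0r|rewrite expr1n mulr1].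
by move=> i ij; rewrite dotZl oe.1 ?mulr0 //; move: ij => /eqP ij eij; apply/ij/val_inj.
Qed.

Lemma fourier_basis j : (j < n)%N -> fourier e n (e j) = e j.
Proof.
move=> jn; rewrite /fourier (bigD1 (Ordinal jn)) //= big1 ?addr0.
  rewrite dotxx //.
  by have [->|->] := oe.2 j jn; [rewrite scaler0|rewrite expr1n scale1r].
by move=> i ij; rewrite oe.1 ?scale0r // => eij; move: ij => /eqP; apply; apply/val_inj.
Qed.

Lemma dot_residual x j : (j < n)%N -> dot (x - fourier e n x) (e j) = 0.
Proof. by move=> jn; rewrite dotBl dot_fourier // subrr. Qed.

Lemma dot_span x y : (forall j, (j < n)%N -> dot x (e j) = 0) ->
  dot x (fourier e n y) = 0.
Proof.
by move=> h; rewrite dot_sumr big1 // => i _; rewrite dotZr h ?mulr0.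
Qed.

Lemma nrm_sum_orthosys (c : nat -> R[i]) :
  nrm (\sum_(k < n) c k *: e k) ^+ 2 = \sum_(k < n) (nrm (c k) * nrm (e k)) ^+ 2.
Proof.
suff h : forall m, (m <= n)%N -> nrm (\sum_(k < m) c k *: e k) ^+ 2 =
    \sum_(k < m) (nrm (c k) * nrm (e k)) ^+ 2 by exact: h.
elim=> [|m IH] mn; first by rewrite !big_ord0 nrm0 expr0n.
rewrite !big_ord_recr /= (pythagoras norm_dot); first by rewrite IH ?nrmZ // ltnW.
rewrite dot_suml big1 // => i _; rewrite dotZl dotZr oe.1 ?mulr0 //.
  exact: ltn_trans mn.
by move=> im; have := ltn_ord i; rewrite im ltnn.
Qed.

Lemma nrm_sum_le (c : nat -> R[i]) :
  nrm (\sum_(k < n) c k *: e k) ^+ 2 <= \sum_(k < n) nrm (c k) ^+ 2.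
Proof.
rewrite nrm_sum_orthosys; apply: ler_sum => k _.
rewrite exprMn -[leRHS]mulr1 ler_wpM2l ?sqr_ge0 //.
by rewrite expr_le1 ?nrm_ge0 // orthosys_le1.
Qed.

Lemma nrm_fourier_sq x :
  nrm x ^+ 2 = nrm (fourier e n x) ^+ 2 + nrm (x - fourier e n x) ^+ 2.
Proof.
have {1}-> : x = fourier e n x + (x - fourier e n x) by rewrite addrC subrK.
rewrite (pythagoras norm_dot) // dotC.
by rewrite dot_span ?rmorph0 // => j jn; exact: dot_residual.
Qed.

Lemma nrm_fourier_sum x :
  nrm (fourier e n x) ^+ 2 = \sum_(k < n) nrm (dot x (e k)) ^+ 2.
Proof.
rewrite (nrm_sum_orthosys (fun k => dot x (e k))); apply: eq_bigr => k _.
have [ek|->] := oe.2 k (ltn_ord k); last by rewrite mulr1.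
by rewrite ek dot0r !nrm0 mul0r.
Qed.

Lemma bessel x : \sum_(k < n) nrm (dot x (e k)) ^+ 2 <= nrm x ^+ 2.
Proof.
by rewrite -nrm_fourier_sum (nrm_fourier_sq x) lerDl sqr_ge0.
Qed.

Lemma nrm_fourier_le x : nrm (fourier e n x) <= nrm x.
Proof.
by apply: nrm_le_sq; rewrite ?nrm_ge0 // (nrm_fourier_sq x) lerDl sqr_ge0.
Qed.

Lemma nrm_residual_le x : nrm (x - fourier e n x) <= nrm x.
Proof.
by apply: nrm_le_sq; rewrite ?nrm_ge0 // (nrm_fourier_sq x) lerDr sqr_ge0.
Qed.

(** [x] and [x - y] have the same residual, and taking residuals is a contraction. *)
Lemma fourier_best x y : fourier e n y = y ->
  nrm (x - fourier e n x) <= nrm (x - y).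
Proof.
move=> hy; have -> : x - fourier e n x = (x - y) - fourier e n (x - y).
  by rewrite fourierB hy opprB addrA subrK.
exact: nrm_residual_le.
Qed.

Lemma fourier_mono m y : (m <= n)%N -> fourier e m y = y -> fourier e n y = y.
Proof.
move=> mn hy; rewrite -{1}hy fourier_sum -[RHS]hy; apply: eq_bigr => k _.
by rewrite fourierZ fourier_basis // (leq_trans _ mn).
Qed.

End System.

Lemma bessel2 e f n x y : orthosys n e -> orthosys n f ->
  nrm (\sum_(k < n) dot x (e k) * dot (f k) y) <= nrm x * nrm y.
Proof.
move=> oe of_; apply: (le_trans (nrm_sum _ _ _)).
have -> : \sum_(k < n) nrm (dot x (e k) * dot (f k) y) =
    \sum_(k < n) nrm (dot x (e k)) * nrm (dot y (f k)).
  by apply: eq_bigr => k _; rewrite nrmM [dot (f k) y]dotC nrm_conj.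
by apply: (finite_cauchy_schwarz (a := fun k => nrm (dot x (e k)))
  (b := fun k => nrm (dot y (f k)))); rewrite ?nrm_ge0 //; exact: bessel.
Qed.

(** Since [0^-1 = 0], the zero vector is sent to itself, the degenerate case that [orthosys]
    admits. *)
Definition normalize x : H := ((nrm x)^-1)%:C *: x.

Lemma normalizeP x : normalize x = 0 \/ nrm (normalize x) = 1.
Proof.
rewrite /normalize; have [x0|x0] := eqVneq (nrm x) 0.
  by left; rewrite (nrm_eq0 x0) scaler0.
by right; rewrite nrmZr ger0_norm ?invr_ge0 ?nrm_ge0 // mulVf.
Qed.

Lemma normalizeK x : (nrm x)%:C *: normalize x = x.
Proof.
rewrite /normalize; have [x0|x0] := eqVneq (nrm x) 0.
  by rewrite (nrm_eq0 x0) !scaler0.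
by rewrite scalerA -rmorphM /= mulfV // scale1r.
Qed.

Lemma normalize_neq0 x : x <> 0 -> nrm (normalize x) = 1.
Proof.
move=> x0; have [n0|//] := normalizeP x.
by exfalso; apply: x0; rewrite -(normalizeK x) n0 scaler0.
Qed.

(** One step of Gram-Schmidt. If [x] is already in the span, the new vector is zero and both
    conclusions persist. *)
Lemma orthosys_residual n e x : orthosys n e ->
  e n = normalize (x - fourier e n x) ->
  orthosys n.+1 e /\ fourier e n.+1 x = x.
Proof.
move=> oe en; have oe' : orthosys n.+1 e.
  apply: orthosysS => // [j jn|]; last by rewrite en; exact: normalizeP.
  by rewrite en dotZl dot_residual ?mulr0.
split=> //; set r := x - fourier e n x.
have -> : x = r + fourier e n x by rewrite subrK.
rewrite fourierD [X in _ + X](fourier_mono oe' (leqnSn n)); last first.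
  by rewrite fourier_sum; apply: eq_bigr => k _; rewrite fourierZ fourier_basis.
congr (_ + _); rewrite -{1}(normalizeK r) -en fourierZ fourier_basis // en.
exact: normalizeK.
Qed.

Lemma fourier_mkseq e n x : fourier (nth 0 (mkseq e n)) n x = fourier e n x.
Proof. by apply: eq_bigr => k _; rewrite nth_mkseq. Qed.

(** A crude bound for arbitrary vectors: the construction of a basis must continue every prefix,
    orthonormal or not. *)
Lemma nrm_fourier_lipschitz e n x :
  nrm (fourier e n x) <= nrm x * \sum_(k < n) nrm (e k) ^+ 2.
Proof.
rewrite mulr_sumr; apply: (le_trans (nrm_sum _ _ _)); apply: ler_sum => k _.
by rewrite nrmZ expr2 mulrA ler_wpM2r ?nrm_ge0 // cauchy_schwarz.
Qed.

Lemma gram_schmidt (v : nat -> H) : exists e,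
  (forall n, orthosys n e) /\ (forall n k, (k < n)%N -> fourier e n (v k) = v k).
Proof.
pose P (s : seq H) x :=
  x = normalize (v (size s) - fourier (nth 0 s) (size s) (v (size s))).
have [|e he] := @prefix_choice _ P; first by move=> s; eexists.
have en n : e n = normalize (v n - fourier e n (v n)).
  by rewrite he size_mkseq fourier_mkseq.
have oe n : orthosys n e.
  by elim: n => [|n /orthosys_residual /(_ (en n)) []//]; split.
exists e; split=> // n k kn; apply: (fourier_mono (oe n) kn).
exact: (orthosys_residual (oe k) (en k)).2.
Qed.

Lemma linear_fourier e n : linear (fourier e n).
Proof. by move=> a x y; rewrite fourierD fourierZ. Qed.

Lemma dense_seq : @separable_space R H ->
  exists d : nat -> H, forall x (r : R), 0 < r -> exists k, nrm (x - d k) < r.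
Proof.
move=> [D [/countable_injP [f finj] Dd]].
exists (fun n => xget 0 [set x | D x /\ f x = n]) => x r r0.
have [||y [By Dy]] := Dd (ball x r%:C).
- by exists x; apply: ballxx; rewrite ltcR.
- by apply: ball_open; rewrite ltcR.
exists (f y); case: xgetP => [z _ [Dz fz]|/(_ y)]; last by case.
rewrite (finj z y) ?inE //.
by move: By; rewrite -ball_normE /ball_ /= nrmE ltcR.
Qed.

(** Gram-Schmidt applied to a dense sequence, skipping the vectors with zero residual so that every
    basis vector has length one. *)
Lemma exists_orthonormal_basis :
  @separable_space R H -> infinite_dimensional H ->
  exists e, orthonormal_basis dot e.
Proof.
move=> /dense_seq [d hd] Hinf.
pose res (s : seq H) x := x - fourier (nth 0 s) (size s) x.
(* If all residuals of the dense sequence vanished, so would those of every [x] by the Lipschitz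
   bound, and finitely many vectors would span [H]. *)
have res_ex s : exists k, res s (d k) <> 0.
  apply: contrapT => /forallNP hN; apply: (Hinf (size s)).
  exists (fun i => nth 0 s i) => x _; exists (fun i => dot x (nth 0 s i)).
  apply/eqP; rewrite -subr_eq0; apply/eqP/nrm_eq0/eqP.
  rewrite eq_le nrm_ge0 andbT; apply/ler_addgt0Pr => r r0; rewrite add0r.
  pose C := 1 + \sum_(k < size s) nrm (nth 0 s k) ^+ 2.
  have Cp : 0 < C by rewrite ltr_pwDl // sumr_ge0 // => k _; exact: sqr_ge0.
  have [k hk] := hd x (r / C) (divr_gt0 r0 Cp).
  have <- : res s (x - d k) = x - fourier (nth 0 s) (size s) x.
    have /contrapT /eqP := hN k; rewrite /res subr_eq0 => /eqP h.
    by rewrite fourierB opprB -h subrKA.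
  rewrite /res (le_trans (nrmD _ _)) // nrmN.
  apply: (@le_trans _ _ (nrm (x - d k) * C)).
    by rewrite mulrDr mulr1 lerD2l nrm_fourier_lipschitz.
  by rewrite -ler_pdivlMr // ltW.
(* The least admissible [m] is taken, so that no [d k] is left behind and all of them end up in the
   span. *)
pose P (s : seq H) x := exists m, [/\ x = normalize (res s (d m)),
  res s (d m) <> 0 & forall k, (k < m)%N -> res s (d k) = 0].
have [s|e he] := @prefix_choice _ P.
  have ex : exists m, `[< res s (d m) <> 0 >].
    by have [m hm] := res_ex s; exists m; apply/asboolP.
  exists (normalize (res s (d (ex_minn ex)))), (ex_minn ex).
  case: ex_minnP => m /asboolP hm hmin; split=> // k km.
  apply: contrapT => /asboolP /hmin; by rewrite leqNgt km.
have {}he n : exists m, [/\ e n = normalize (d m - fourier e n (d m)),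
    d m - fourier e n (d m) <> 0 &
    forall k, (k < m)%N -> fourier e n (d k) = d k].
  have [m [h1 h2 h3]] := he n; exists m.
  rewrite /res size_mkseq fourier_mkseq in h1 h2.
  split=> // k /h3 /eqP; rewrite /res size_mkseq fourier_mkseq subr_eq0.
  by move=> /eqP <-.
have oe n : orthosys n e.
  elim: n => [|n IH]; first by split.
  by have [m [h1 _ _]] := he n; exact: (orthosys_residual IH h1).1.
have spans n : forall k, (k < n)%N -> fourier e n (d k) = d k.
  elim: n => [//|n IH] k; rewrite ltnS => kn.
  have [ltkn|/(conj kn)/andP] := ltnP k n.
    by apply: (fourier_mono (oe n.+1) (leqnSn n)); exact: IH.
  rewrite -eqn_leq => /eqP ->.
  (* An index [m] below [n] is impossible, as [d m] is then already spanned. If [m] exceeds [n],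
     minimality says that [d n] is already spanned; if they agree, [d n] has just been added. *)
  have [m [h1 h2 h3]] := he n; have [mn|nm|mn] := ltngtP m n.
  - by exfalso; apply: h2; rewrite IH ?subrr.
  - by apply: (fourier_mono (oe n.+1) (leqnSn n)); exact: h3.
  - by rewrite mn in h1; exact: (orthosys_residual (oe n) h1).2.
exists e; split=> [i j|x].
  have [->|/eqP ij] := eqVneq i j.
    have [m [h1 h2 _]] := he j.
    by rewrite dotxx // h1 normalize_neq0 // expr1n.
  exact: ((oe (maxn i j).+1).1 _ _ (leq_maxl i j) (leq_maxr i j)).
apply/cvg_seqP => r r0; have [k hk] := hd x r r0.
exists k.+1 => n kn; rewrite big_mkord nrm_sub.
apply: le_lt_trans hk; apply: (fourier_best (oe n)).
by apply: (fourier_mono (oe n) kn); exact: spans.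
Qed.

End OrthogonalSystems.

(** * Bounded operators, singular numbers and projections *)

(** A first-order term dominated by a second-order one vanishes: take for [a] the multiple of [d] by
    [1 / (|C| + 1)]. It yields orthogonality from extremality, for nearest points and for norm
    maximisers. *)
Lemma variation_eq0 (R : realType) (d : R[i]) (C : R) :
  (forall a, 2 * complex.Re (Num.conj a * d) <= nrm a ^+ 2 * C) -> d = 0.
Proof.
move=> h; apply: nrm_eq0.
have C1 : 0 < `|C| + 1 by rewrite ltr_wpDl.
have C0 := ltW C1.
have := h ((`|C| + 1)^-1%:C * d).
rewrite rmorphM /= conj_real -mulrA (mulrC (Num.conj d)) mul_conjE ReZ /= nrmM.
rewrite nrm_real exprMn (@ger0_norm _ _^-1) ?invr_ge0 // => {}h.
apply/eqP; rewrite -sqrf_eq0 eq_le sqr_ge0 andbT.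
have e : (`|C| + 1)^-1 ^+ 2 * nrm d ^+ 2 * C <= (`|C| + 1)^-1 * nrm d ^+ 2.
  rewrite -mulrA expr2 -mulrA ler_wpM2l ?invr_ge0 //.
  rewrite mulrCA ler_piMr ?sqr_ge0 // mulrC ler_pdivrMr // mul1r.
  by rewrite (le_trans (ler_norm C)) // lerDl.
have {e}h := le_trans h e.
have : (`|C| + 1)^-1 * nrm d ^+ 2 <= 0 by move: h; lra.
by rewrite pmulr_rle0 // invr_gt0.
Qed.

Section BoundedOperators.
Variables (R : realType) (H : completeNormedModType R[i]).
Implicit Types (T F A B : H -> H) (x y : H) (a : R[i]) (V : set H).

Section Linear.
Variable T : H -> H.
Hypothesis lT : linear T.

Lemma linD x y : T (x + y) = T x + T y.
Proof. by have := lT 1 x y; rewrite !scale1r. Qed.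

Lemma lin0 : T 0 = 0.
Proof. by apply: (addrI (T 0)); rewrite -linD !addr0. Qed.

Lemma linZ a x : T (a *: x) = a *: T x.
Proof. by have := lT a x 0; rewrite lin0 !addr0. Qed.

Lemma linB x y : T (x - y) = T x - T y.
Proof. by rewrite -scaleN1r linD linZ scaleN1r. Qed.

Lemma lin_sum I (r : seq I) (P : pred I) (F : I -> H) :
  T (\sum_(i <- r | P i) F i) = \sum_(i <- r | P i) T (F i).
Proof. by apply: (big_morph T); [exact: linD|exact: lin0]. Qed.

End Linear.

Lemma linear_comp T A : linear T -> linear A -> linear (T \o A).
Proof. by move=> lT lA a x y; rewrite /= lA lT. Qed.

Lemma linear_subf T A : linear T -> linear A -> linear (T \- A).
Proof.
by move=> lT lA a x y; rewrite /= lT lA scalerBr opprD addrACA.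
Qed.

Lemma nrm_unit_le x : (`|x| <= 1) = (nrm x <= 1).
Proof. by rewrite nrmE -lecR. Qed.

Lemma bounded_operatorP T : bounded_operator T <->
  linear T /\ exists2 C : R, 0 <= C & forall x, nrm (T x) <= C * nrm x.
Proof.
split=> [[lT cT]|[lT [C C0 hC]]]; last first.
  split=> // x; apply/cvg_nrmP => e e0.
  have C1 : 0 < C + 1 by rewrite ltr_wpDl.
  have /(@cvg_nrmP R H H (nbhs x) _ id x) /(_ _ (divr_gt0 e0 C1)) : (id @ x --> x) by [].
  apply: filterS => t; rewrite -linB // ltr_pdivlMr // => ht.
  apply: le_lt_trans ht; apply: (le_trans (hC _)).
  by rewrite mulrC ler_wpM2l ?nrm_ge0 // lerDl.
split=> //.
have /(@cvg_nrmP R H H (nbhs 0) _ T (T 0)) /(_ _ ltr01) := cT 0.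
move=> /nbhs_ballP [d0 /gt0_complexP [d d_gt0 ->] hd].
(* Continuity at 0 with tolerance 1 gave the radius [d]; a nonzero vector rescaled to length [d / 2]
   is therefore mapped into the unit ball. *)
exists (2 / d) => [|x]; first by rewrite divr_ge0 ?ltW.
have [x0|x0] := eqVneq (nrm x) 0.
  by rewrite (nrm_eq0 x0) lin0 // nrm0 mulr0.
have xp : 0 < nrm x by rewrite lt0r x0 nrm_ge0.
pose r : R := d / 2 / nrm x.
have rp : 0 < r by rewrite !divr_gt0.
have /= := hd (r%:C *: x); rewrite lin0 // subr0 -ball_normE /ball_ /= sub0r.
rewrite nrmE ltcR nrmN nrmZr gtr0_norm // linZ // nrmZr gtr0_norm //.
have -> : r * nrm x = d / 2 by rewrite /r; field.
rewrite ltr_pdivrMr // ltr_pMr // ltr1n => /(_ isT) h.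
have := ltW h; rewrite mulrC -ler_pdivlMr // => h2; apply: (le_trans h2).
by rewrite le_eqVlt; apply/orP; left; apply/eqP; rewrite /r; field; rewrite x0 gt_eqF.
Qed.

Lemma bounded_lin T : bounded_operator T -> linear T.
Proof. by case. Qed.

Lemma bounded_comp T A :
  bounded_operator T -> bounded_operator A -> bounded_operator (T \o A).
Proof.
move=> /bounded_operatorP [lT [C C0 hC]] /bounded_operatorP [lA [D D0 hD]].
apply/bounded_operatorP; split; first exact: linear_comp.
exists (C * D) => [|x /=]; first by rewrite mulr_ge0.
by rewrite (le_trans (hC _)) // -mulrA ler_wpM2l.
Qed.

Lemma bounded_sub T A :
  bounded_operator T -> bounded_operator A -> bounded_operator (T \- A).
Proof.
move=> /bounded_operatorP [lT [C C0 hC]] /bounded_operatorP [lA [D D0 hD]].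
apply/bounded_operatorP; split; first exact: linear_subf.
exists (C + D) => [|x /=]; first by rewrite addr_ge0.
by rewrite (le_trans (nrmD _ _)) // nrmN mulrDl lerD.
Qed.

Lemma bounded_operator0 : bounded_operator (fun=> 0 : H).
Proof.
apply/bounded_operatorP; split; first by move=> a x y; rewrite scaler0 addr0.
by exists 0 => // x; rewrite nrm0 mul0r.
Qed.

Lemma contraction_bounded A :
  linear A -> (forall x, nrm (A x) <= nrm x) -> bounded_operator A.
Proof.
by move=> lA hA; apply/bounded_operatorP; split=> //; exists 1 => // x; rewrite mul1r.
Qed.

Lemma opnorm_le T (C : R) :
  (forall x, nrm (T x) <= C * nrm x) -> 0 <= C -> opnorm T <= C.
Proof.
move=> h C0; apply: ge_sup.
  by exists (nrm (T 0)), 0 => //=; rewrite normr0.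
move=> _ [x /= x1 <-]; rewrite -/(nrm _) (le_trans (h x)) //.
by rewrite ler_piMr // -nrm_unit_le.
Qed.

Lemma opnorm_ubound T : bounded_operator T ->
  has_ubound [set complex.Re `|T x| | x in [set x : H | `|x| <= 1]].
Proof.
move=> /bounded_operatorP [lT [C C0 hC]]; exists C => _ [x /= x1 <-].
by rewrite -/(nrm _) (le_trans (hC x)) // ler_piMr // -nrm_unit_le.
Qed.

Lemma opnorm_ge0 T : bounded_operator T -> 0 <= opnorm T.
Proof.
move=> bT; apply: (@le_trans _ _ (nrm (T 0))); first exact: nrm_ge0.
by apply: (ub_le_sup (opnorm_ubound bT)); exists 0 => //=; rewrite normr0.
Qed.

Lemma le_opnorm T x : bounded_operator T -> nrm (T x) <= opnorm T * nrm x.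
Proof.
move=> bT; have lT := bounded_lin bT.
have [x0|x0] := eqVneq (nrm x) 0.
  by rewrite (nrm_eq0 x0) lin0 // !nrm0 mulr0.
have xp : 0 < nrm x by rewrite lt0r x0 nrm_ge0.
rewrite -ler_pdivrMr // mulrC; set r := (nrm x)^-1.
have r0 : 0 <= r by rewrite invr_ge0 nrm_ge0.
rewrite -[r]ger0_norm // -nrmZr -linZ //.
apply: (ub_le_sup (opnorm_ubound bT)); exists (r%:C *: x) => //=.
by rewrite nrm_unit_le nrmZr ger0_norm // mulVf.
Qed.

Lemma dim_leP n V : dim_le n V <-> exists v : nat -> H, forall x, V x ->
  exists a : nat -> R[i], x = \sum_(k < n) a k *: v k.
Proof.
split=> [[v hv]|[v hv]]; last first.
  exists (fun i => v i) => x /hv [a ->]; by exists (fun i => a i).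
exists (fun k => if insub k is Some i then v i else 0) => x /hv [a ->].
exists (fun k => if insub k is Some i then a i else 0).
by apply: eq_bigr => i _; rewrite valK.
Qed.

Lemma dim_leW m n V : (m <= n)%N -> dim_le m V -> dim_le n V.
Proof.
move=> mn /dim_leP [v hv]; apply/dim_leP; exists v => x /hv [a ->].
exists (fun k => if (k < m)%N then a k else 0).
rewrite (big_ord_widen n (fun k => a k *: v k)) // big_mkcond /=.
by apply: eq_bigr => i _; case: ifP => // _; rewrite scale0r.
Qed.

Lemma dim_le_image n A F B : linear A ->
  dim_le n (range F) -> dim_le n (range (A \o F \o B)).
Proof.
move=> lA /dim_leP [v hv]; apply/dim_leP; exists (A \o v) => _ [x _ <-].
have [a ha] := hv (F (B x)) (ex_intro2 _ _ (B x) I erefl).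
by exists a; rewrite /= ha lin_sum //; apply: eq_bigr => k _; rewrite linZ.
Qed.

Section SingularNumbers.
Variable T : H -> H.
Hypothesis bT : bounded_operator T.

Lemma snum_lbound n : has_lbound [set opnorm (T \- F)
   | F in [set F | bounded_operator F /\ dim_le n (range F)]].
Proof. by exists 0 => _ [F [bF _] <-]; exact/opnorm_ge0/bounded_sub. Qed.

Lemma dim_le0 n : dim_le n (range (fun _ : H => 0 : H)).
Proof.
apply/dim_leP; exists (fun=> 0) => _ [_ _ <-]; exists (fun=> 0).
by rewrite big1 // => i _; rewrite scaler0.
Qed.

Lemma snum_le n F : bounded_operator F -> dim_le n (range F) ->
  snum T n <= opnorm (T \- F).
Proof. by move=> bF dF; apply: (ge_inf (snum_lbound n)); exists F. Qed.

Lemma snum_ge n (c : R) :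
  (forall F, bounded_operator F -> dim_le n (range F) -> c <= opnorm (T \- F)) ->
  c <= snum T n.
Proof.
move=> h; apply: lb_le_inf; last by move=> _ [F [bF dF] <-]; exact: h.
exists (opnorm (T \- (fun _ : H => 0))), (fun _ : H => 0) => //.
by split; [exact: bounded_operator0|exact: dim_le0].
Qed.

Lemma snum_lt n (c : R) : snum T n < c -> exists F,
  [/\ bounded_operator F, dim_le n (range F) & opnorm (T \- F) < c].
Proof.
move=> h; apply: contrapT => hN; move: h; rewrite ltNge; apply/negP/negPn.
apply: snum_ge => F bF dF; rewrite leNgt; apply/negP => Fc.
by apply: hN; exists F.
Qed.

Lemma snum_ge0 n : 0 <= snum T n.
Proof. by apply: snum_ge => F bF _; exact/opnorm_ge0/bounded_sub. Qed.

Lemma snum_nonincreasing m n : (m <= n)%N -> snum T n <= snum T m.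
Proof.
move=> mn; apply: snum_ge => F bF dF.
by apply: snum_le => //; exact: dim_leW dF.
Qed.

(** If [F] approximates [T], then [A \o F \o B] approximates [A \o T \o B] at least as well, with a
    range spanned by no more vectors. *)
Lemma snum_contraction A B n : linear A -> linear B ->
  (forall x, nrm (A x) <= nrm x) -> (forall x, nrm (B x) <= nrm x) ->
  snum (A \o T \o B) n <= snum T n.
Proof.
move=> lA lB cA cB; have bA := contraction_bounded lA cA.
have bB := contraction_bounded lB cB.
apply/ler_addgt0Pr => e e0.
have [|F [bF dF TF]] := @snum_lt n (snum T n + e); first by rewrite ltrDl.
apply: le_trans (ltW TF); apply: le_trans (_ : opnorm ((A \o T \o B) \- (A \o F \o B)) <= _).
  apply: ge_inf.
    by exists 0 => _ [G [bG _] <-]; apply/opnorm_ge0/bounded_sub => //;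
       exact/bounded_comp/bB/bounded_comp.
  exists (A \o F \o B) => //; split; last exact: dim_le_image.
  exact/bounded_comp/bB/bounded_comp.
have bTF := bounded_sub bT bF.
apply: opnorm_le => [x|]; last exact: opnorm_ge0.
rewrite /= -linB // (le_trans (cA _)) //.
have -> : T (B x) - F (B x) = (T \- F) (B x) by [].
by rewrite (le_trans (le_opnorm _ bTF)) // ler_wpM2l // opnorm_ge0.
Qed.

End SingularNumbers.

End BoundedOperators.

Local Notation proj := Defs.proj.

Section HilbertSpace.
Variables (R : realType) (H : completeNormedModType R[i]).
Variable dot : {dot H for Num.conj}.
Hypothesis norm_dot : forall x : H, `|x| ^+ 2 = dot x x.
Implicit Types (x y z : H) (a : R[i]) (V M : set H) (T : H -> H).

Lemma dim_le_orthosys n V : dim_le n V ->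
  exists e, (forall m, orthosys dot m e) /\ forall x, V x -> fourier dot e n x = x.
Proof.
move=> /dim_leP [v hv]; have [e [oe he]] := gram_schmidt norm_dot v.
exists e; split=> // x /hv [a ->]; rewrite fourier_sum.
by apply: eq_bigr => k _; rewrite fourierZ he.
Qed.

Lemma orthosys_dim_le (e : nat -> H) n V :
  (forall x, V x -> fourier dot e n x = x) -> dim_le n V.
Proof.
move=> h; apply/dim_leP; exists e => x /h hx.
by exists (fun k => dot x (e k)); rewrite -{1}hx.
Qed.

Lemma nearest_orthogonal w z :
  (forall a, nrm w <= nrm (w - a *: z)) -> dot w z = 0.
Proof.
move=> h; apply: (@variation_eq0 _ _ (nrm z ^+ 2)) => a.
have := h a; rewrite -(@ler_pXn2r _ 2) ?nnegrE ?nrm_ge0 //.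
by rewrite (nrmB_sq norm_dot) dotZr nrmZ exprMn; lra.
Qed.

Section Projection.
Variable M : set H.
Hypothesis cM : closed_subspace M.

Let MZ a x : M x -> M (a *: x).
Proof. by case: cM => _ M0 ML Mx; rewrite -[a *: x]addr0; exact: ML. Qed.

Let MD x y : M x -> M y -> M (x + y).
Proof. by case: cM => _ M0 ML Mx My; rewrite -[x]scale1r; exact: ML. Qed.

Let MB x y : M x -> M y -> M (x - y).
Proof. by move=> Mx My; rewrite -scaleN1r; apply/MD/MZ. Qed.

(** A sequence in [M] minimising the distance to [x] is Cauchy by the parallelogram law, and its
    limit is the foot of the perpendicular. [D] is the squared distance from [x] to [M]. *)
Lemma proj_exists x : exists y, M y /\ forall z, M z -> dot (x - y) z = 0.
Proof.
have M0 : M 0 by case: cM.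
have [D hD approxD] : exists2 D : R, forall y, M y -> D <= nrm (x - y) ^+ 2 &
    forall e, 0 < e -> exists y, M y /\ nrm (x - y) ^+ 2 < D + e.
  exists (inf [set nrm (x - y) ^+ 2 | y in M]) => [y My|e e0].
    by apply: ge_inf; [exists 0 => _ [z _ <-]; exact: sqr_ge0|exists y].
  have /inf_lt [|_ [y My <-] hy] : inf [set nrm (x - y) ^+ 2 | y in M] <
      inf [set nrm (x - y) ^+ 2 | y in M] + e by rewrite ltrDl.
  - by exists (nrm (x - 0) ^+ 2), 0.
  - by exists y.
have /choice [y hy] : forall n : nat, exists y, M y /\
    nrm (x - y) ^+ 2 < D + n.+1%:R^-1.
  by move=> n; apply: approxD; rewrite invr_gt0.
(* The midpoint of [y n] and [y m] lies in [M], hence at squared distance at least [D] from [x];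
   this cancels the [4 * D] produced by the parallelogram law. *)
have near_ n m : nrm (y n - y m) ^+ 2 <= 2 * n.+1%:R^-1 + 2 * m.+1%:R^-1.
  have := parallelogram norm_dot (x - y n) (x - y m).
  have -> : x - y n - (x - y m) = - (y n - y m).
    by rewrite !opprB addrC addrA subrK.
  have -> : x - y n + (x - y m) = 2%:R *: (x - 2%:R^-1 *: (y n + y m)).
    rewrite scalerBr scalerA divff ?pnatr_eq0 // scale1r scaler_nat mulr2n.
    by rewrite opprD addrACA.
  rewrite nrmN nrmZ exprMn.
  have -> : nrm (2%:R : R[i]) = 2.
    by rewrite -[2%:R](rmorph_nat (real_complex R)) nrm_real ger0_norm.
  have := hD _ (MZ 2%:R^-1 (MD (hy n).1 (hy m).1)).
  have := (hy n).2; have := (hy m).2.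
  move: (n.+1%:R^-1) (m.+1%:R^-1) => u v; lra.
have [r r0|y0 yc] := @cauchy_seq_cvg _ _ y.
  have [N hN] := eventually_inv_lt (divr_gt0 (exprn_gt0 2 r0) (ltr0n _ 4)).
  exists N => n m /hN hn /hN hm.
  rewrite -(@ltr_pXn2r _ 2) ?nnegrE ?nrm_ge0 ?ltW //.
  apply: le_lt_trans (near_ n m) _; move: hn hm.
  move: (n.+1%:R^-1) (m.+1%:R^-1) => u v; lra.
have My0 : M y0.
  have [clM _ _] := cM; apply: (@closed_cvg _ _ _ _ y M clM _ _ yc).
  by apply: nearW => n; exact: (hy n).1.
exists y0; split=> // z Mz; apply: nearest_orthogonal => a.
rewrite -addrA -opprD; set w := y0 + a *: z.
have Mw : M w by apply/MD/MZ.
apply/ler_addgt0Pr => e e0.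
(* The excess [e ^+ 2] over [D <= nrm (x - w) ^+ 2] is absorbed by the square of
   [nrm (x - w) + e]. *)
have [N hN] := eventually_inv_lt (exprn_gt0 2 e0).
apply: (@nrm_cvg_le _ _ (fun n => x - y n) _ _ N).
  by apply: cvgB => //; exact: cvg_cst.
move=> n /hN hn; apply: nrm_le_sq; first by rewrite addr_ge0 ?nrm_ge0 ?ltW.
have := mulr_ge0 (nrm_ge0 (x - w)) (ltW e0).
have := (hy n).2; have := hD _ Mw; move: hn; rewrite sqrrD mulr2n.
move: (n.+1%:R^-1) => u; lra.
Qed.

Lemma projP x : M (proj dot M x) /\ forall z, M z -> dot (x - proj dot M x) z = 0.
Proof.
rewrite /proj; case: xgetP => [y _ //|h].
by have [y hy] := proj_exists x; have := h y; case.
Qed.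

Lemma proj_eq x y : M y -> (forall z, M z -> dot (x - y) z = 0) ->
  proj dot M x = y.
Proof.
move=> My hy; have [Mp hp] := projP x.
apply/eqP; rewrite -subr_eq0; apply/eqP.
have Mpy := MB Mp My; apply: nrm_eq0; apply/eqP.
rewrite -sqrf_eq0 (nrm_sq norm_dot) {1}(_ : _ - y = (x - y) - (x - proj dot M x)).
  by rewrite dotBl hy // hp // subrr.
by rewrite opprB [RHS]addrC addrA subrK.
Qed.

Lemma linear_proj : linear (proj dot M).
Proof.
move=> a x y; have [Mx hx] := projP x; have [My hy] := projP y.
apply: proj_eq => [|z Mz]; first exact/MD/My/MZ.
by rewrite opprD addrACA -scalerBr dotDl dotZl hx // hy // mulr0 addr0.
Qed.

Lemma nrm_proj_le x : nrm (proj dot M x) <= nrm x.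
Proof.
have [Mx hx] := projP x; apply: nrm_le_sq; first exact: nrm_ge0.
have {2}-> : x = (x - proj dot M x) + proj dot M x by rewrite subrK.
by rewrite (pythagoras norm_dot (hx _ Mx)) lerDr sqr_ge0.
Qed.

End Projection.

Lemma projT x : proj dot [set: H] x = x.
Proof.
apply: proj_eq => //; last by move=> z _; rewrite subrr dot0l.
Qed.

Lemma compact_comp_proj T M : closed_subspace M -> compact_operator T ->
  compact_operator (T \o proj dot M).
Proof.
move=> cM [bT cT]; have bP := contraction_bounded (linear_proj cM) (nrm_proj_le cM).
split; first exact: bounded_comp.
apply: (subclosed_compact _ cT); first exact: closed_closure.
apply: closureS => _ [x /= x1 <-]; exists (proj dot M x) => //=.
by move: x1; rewrite !nrm_unit_le; exact/le_trans/nrm_proj_le.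
Qed.

End HilbertSpace.

(** * Compact operators *)

Section CompactOperators.
Variables (R : realType) (H : completeNormedModType R[i]).
Variable dot : {dot H for Num.conj}.
Hypothesis norm_dot : forall x : H, `|x| ^+ 2 = dot x x.
Implicit Types (x y z : H) (a : R[i]) (V M : set H) (T : H -> H).

(** A cluster point of the images, visited arbitrarily late, takes the place of a convergent
    subsequence. *)
Lemma compact_seq_cluster T (z : nat -> H) : compact_operator T ->
  (forall n, nrm (z n) <= 1) ->
  exists y, forall (e : R) N, 0 < e ->
    exists2 n, (N <= n)%N & nrm (T (z n) - y) < e.
Proof.
move=> [_ cT] z1.
have [|y [_ yc]] := cT ((T \o z) @ \oo) _.
  exists 0%N => // n _ /=; apply: subset_closure; exists (z n) => //=.
  by rewrite nrm_unit_le.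
exists y => e N e0.
have [||_ [[n Nn <-] hn]] := yc [set T (z n) | n in [set n | (N <= n)%N]] (ball y e%:C).
- by exists N => // n /= Nn; exists n.
- by apply: nbhsx_ballx; rewrite ltcR.
exists n => //; move: hn; rewrite -ball_normE /ball_ /= nrmE ltcR.
by rewrite nrm_sub.
Qed.

(* If T x_k converges to a vector of maximal length then
   `|x_k + x_l| --> 2, so (x_k) is Cauchy by the parallelogram law. *)
Lemma norm_attained T V : compact_operator T -> closed_subspace V ->
  exists x, [/\ V x, x = 0 \/ nrm x = 1 &
    forall z, V z -> nrm (T z) <= nrm (T x) * nrm z].
Proof.
move=> cT [clV V0 VL]; have bT := cT.1; have lT := bounded_lin bT.
have VZ a x : V x -> V (a *: x) by move=> Vx; rewrite -[a *: x]addr0; exact: VL.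
have VD x y : V x -> V y -> V (x + y) by move=> Vx Vy; rewrite -[x]scale1r; exact: VL.
pose S := [set nrm (T z) | z in [set z | V z /\ nrm z <= 1]].
have S0 : S !=set0 by exists (nrm (T 0)), 0 => //; split=> //; rewrite nrm0.
have Sb : has_ubound S.
  exists (opnorm T) => _ [z [_ z1] <-]; apply: le_trans (le_opnorm z bT) _.
  by rewrite ler_piMr // opnorm_ge0.
pose sg := sup S.
have S_le z : V z -> nrm z <= 1 -> nrm (T z) <= sg.
  by move=> Vz z1; apply: ub_le_sup => //; exists z.
have sg_ge0 : 0 <= sg by apply: le_trans (S_le _ V0 _); rewrite ?nrm_ge0 ?nrm0.
have S_leZ z : V z -> nrm (T z) <= sg * nrm z.
  move=> Vz; have [z0|z0] := eqVneq (nrm z) 0.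
    by rewrite (nrm_eq0 z0) lin0 // !nrm0 mulr0.
  have zp : 0 < nrm z by rewrite lt0r z0 nrm_ge0.
  rewrite -ler_pdivrMr // mulrC -[_^-1]ger0_norm ?invr_ge0 ?nrm_ge0 //.
  rewrite -nrmZr -linZ // S_le //; first exact: VZ.
  by rewrite nrmZr ger0_norm ?invr_ge0 ?nrm_ge0 // mulVf.
(* When [T] vanishes on [V], in particular when [V] is zero, the zero vector is returned; this is
   why the conclusion allows [x = 0]. *)
have [sg0|sgn] := eqVneq sg 0.
  exists 0; split=> //; first by left.
  by move=> z Vz; rewrite lin0 // nrm0 mul0r -(mul0r (nrm z)) -sg0 S_leZ.
have sgp : 0 < sg by rewrite lt0r sgn.
have /choice [z hz] : forall n : nat, exists z, [/\ V z, nrm z <= 1 &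
    sg - n.+1%:R^-1 < nrm (T z)].
  move=> n; have : sg - n.+1%:R^-1 < sg by rewrite ltrBlDr ltrDl invr_gt0.
  by move=> /(sup_gt S0) [_ [z [Vz z1] <-] h]; exists z.
have [|y hy] := compact_seq_cluster cT (z := z).
  by move=> n; have [] := hz n.
(* Reselection along the cluster point: the images now converge to [y] and the lengths to [sg], both
   at rate [1 / (k + 1)]. *)
have /choice [x hx] : forall k : nat, exists x, [/\ V x, nrm x <= 1,
    nrm (T x - y) < k.+1%:R^-1 & sg - k.+1%:R^-1 < nrm (T x)].
  move=> k; have kp : 0 < k.+1%:R^-1 :> R by rewrite invr_gt0.
  have [n kn hn] := hy _ k kp; have [Vz z1 h] := hz n.
  exists (z n); split=> //; apply: le_lt_trans h.
  by rewrite lerD2l lerN2 lef_pV2 ?posrE // ler_nat.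
have near_ k l : nrm (x k - x l) ^+ 2 * sg <=
    12 * (k.+1%:R^-1 + l.+1%:R^-1).
  have [Vk k1 ky kT] := hx k; have [Vl l1 ly lT'] := hx l.
  have h1 : 2 * sg - 3 * k.+1%:R^-1 - l.+1%:R^-1 <= sg * nrm (x k + x l).
    apply: le_trans (S_leZ _ (VD _ _ Vk Vl)).
    rewrite linD //.
    have h2 := nrm_triangle (T (x k) + T (x k)) (T (x k) + T (x l)).
    have h3 := nrmDD (T (x k)).
    have h4 : nrm (T (x k) + T (x k) - (T (x k) + T (x l))) <=
        k.+1%:R^-1 + l.+1%:R^-1.
      rewrite opprD addrACA subrr add0r.
      apply: (le_trans (nrmB_le _ y _)); rewrite (nrm_sub y); exact/lerD/ltW/ly/ltW/ky.
    move: kT h2 h4; rewrite h3.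
    move: (k.+1%:R^-1) (l.+1%:R^-1) => u v; lra.
  have u0 : 0 <= k.+1%:R^-1 :> R by rewrite invr_ge0.
  have v0 : 0 <= l.+1%:R^-1 :> R by rewrite invr_ge0.
  have := parallelogram norm_dot (x k) (x l).
  have k2 : nrm (x k) ^+ 2 <= 1 by rewrite expr_le1 ?nrm_ge0.
  have l2 : nrm (x l) ^+ 2 <= 1 by rewrite expr_le1 ?nrm_ge0.
  (* The tangent to the square at 2 makes the parallelogram law linear in [nrm (x k + x l)].
     Multiplying [h1] by 4 then produces the constant 12. *)
  have p2 : 4 * nrm (x k + x l) - 4 <= nrm (x k + x l) ^+ 2.
    by rewrite -subr_ge0 (_ : _ - _ = (nrm (x k + x l) - 2) ^+ 2) ?sqr_ge0 //; ring.
  move: h1 u0 v0 k2 l2 p2.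
  move: (k.+1%:R^-1) (l.+1%:R^-1) (nrm (x k + x l)) (nrm (x k - x l) ^+ 2) => u v p q.
  move: (nrm (x k) ^+ 2) (nrm (x l) ^+ 2) => A B h1 u0 v0 k2 l2 p2 par.
  have : q <= 8 - 4 * p by lra.
  move=> /(ler_wpM2r sg_ge0) h; apply: le_trans h _.
  have -> : (8 - 4 * p) * sg = 8 * sg - 4 * (sg * p) by ring.
  lra.
have [r r0|x0 xc] := @cauchy_seq_cvg _ _ x.
  have rp : 0 < r ^+ 2 * sg / 24 by rewrite divr_gt0 // mulr_gt0 // exprn_gt0.
  have [N hN] := eventually_inv_lt rp.
  exists N => n m /hN hn /hN hm.
  rewrite -(@ltr_pXn2r _ 2) ?nnegrE ?nrm_ge0 ?ltW // -(ltr_pM2r sgp).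
  apply: le_lt_trans (near_ n m) _; move: hn hm.
  move: (n.+1%:R^-1) (m.+1%:R^-1) => u v; lra.
have Vx0 : V x0.
  apply: (@closed_cvg _ _ _ _ x V clV _ _ xc).
  by apply: nearW => n; have [] := hx n.
have x1 : nrm x0 <= 1.
  by apply: (nrm_cvg_le (N := 0%N) xc) => n _; have [] := hx n.
have sx : sg <= nrm (T x0).
  apply/ler_addgt0Pr => e e0.
  have C1 : 0 < opnorm T + 1 by rewrite ltr_wpDl // opnorm_ge0.
  have e2 : 0 < e / 2 by rewrite divr_gt0.
  have [N1 h1] := eventually_inv_lt e2.
  have /cvg_seqP /(_ _ (divr_gt0 e2 C1)) [N2 h2] := xc.
  pose n := maxn N1 N2.
  have [_ _ _ h3] := hx n; have h4 := h1 n (leq_maxl _ _).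
  have h5 := h2 n (leq_maxr _ _).
  have h6 : nrm (T (x n) - T x0) <= e / 2.
    rewrite -linB // (le_trans (le_opnorm _ bT)) //.
    apply: (@le_trans _ _ ((opnorm T + 1) * nrm (x n - x0))).
      by rewrite ler_wpM2r ?nrm_ge0 // lerDl.
    by rewrite mulrC -ler_pdivlMr // ltW.
  have := nrm_triangle (T (x n)) (T x0).
  move: h3 h4; move: (n.+1%:R^-1) => u; lra.
have sxE : nrm (T x0) = sg by apply/eqP; rewrite eq_le sx S_le.
exists x0; split=> //; last by rewrite sxE.
right; apply/eqP; rewrite eq_le x1 /= -(ler_pM2l sgp) mulr1.
by rewrite -[leLHS]sxE S_leZ.
Qed.

Definition totally_bounded (A : set H) : Prop := forall e : R, 0 < e ->
  exists s : seq H, forall x, A x -> exists2 y, y \in s & nrm (x - y) < e.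

(** An ultrafilter containing a finite union of balls contains one of them, so it is Cauchy and
    completeness provides the limit. *)
Lemma totally_bounded_compact A : totally_bounded A -> compact (closure A).
Proof.
move=> tA; rewrite compact_ultra => U UU UA.
suff : cvg U.
  move=> /cvg_ex [p Up]; exists p; split=> //.
  exact: (@closed_cvg _ _ _ _ id _ (@closed_closure _ A) _ _ Up).
apply/cauchy_cvgP/cauchy_exP => e0 /gt0_complexP [e ep ->].
have e2 : 0 < e / 2 by rewrite divr_gt0.
have [s hs] := tA _ e2.
have : U (\bigcup_(y in [set` s]) ball y e%:C).
  apply: filterS UA => x xA.
  have [|z [Az xz]] := xA (ball x (e / 2)%:C).
    by apply: nbhsx_ballx; rewrite ltcR.
  have [y ys zy] := hs _ Az; exists y => //.
  move: xz; rewrite -!ball_normE /ball_ /= !nrmE !ltcR => xz.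
  have := nrmB_le y z x; rewrite (nrm_sub y z) (nrm_sub z x); move: xz zy; lra.
elim: s {hs} => [|y s IH].
  by rewrite set_nil bigcup_set0 => /filter_not_empty.
move=> Uor.
have [Uy|Un] := in_ultra_setVsetC (ball y e%:C) UU; first by exists y.
apply: IH; apply: filterS (filterI Uor Un) => x [[z]].
by rewrite /= in_cons => /predU1P[->|zs] // xz _; exists z.
Qed.

Lemma real_net (C e : R) : 0 < e -> exists s : seq R, forall r : R, `|r| <= C ->
  exists2 t, t \in s & `|r - t| < e.
Proof.
move=> e0; pose N := (Num.truncn (2 * C / e)).+1.
exists [seq - C + k%:R * e | k <- iota 0 N] => r; rewrite ler_norml => /andP[r1 r2].
have r0 : 0 <= (r + C) / e by rewrite divr_ge0 ?(ltW e0) //; lra.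
have /andP[k1 k2] := truncn_itv r0; set k := Num.truncn _ in k1 k2.
exists (- C + k%:R * e).
  apply/mapP; exists k => //; rewrite mem_iota add0n /= ltnS.
  by apply: le_truncn; rewrite ler_pM2r ?invr_gt0 //; lra.
move: k1 k2; rewrite ler_pdivlMr // ltr_pdivrMr // -natr1 mulrDl mul1r => k1 k2.
rewrite ger0_norm; lra.
Qed.

Lemma complex_net (C e : R) : 0 < e -> exists s : seq R[i], forall a, nrm a <= C ->
  exists2 b, b \in s & nrm (a - b) < e.
Proof.
move=> e0; have e2 : 0 < e / 2 by rewrite divr_gt0.
have [s hs] := real_net C e2.
exists [seq (u +i* v)%C | u <- s, v <- s] => a aC.
have [|u us hu] := hs (complex.Re a).
  rewrite ler_norml (le_trans (Re_le_nrm a)) // andbT lerNl -ReN.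
  by rewrite (le_trans (Re_le_nrm _)) // nrmN.
have [|v vs hv] := hs (complex.Im a).
  rewrite ler_norml (le_trans (Im_le_nrm a)) // andbT lerNl.
  have -> : - complex.Im a = complex.Im (- a) by case: (a).
  by rewrite (le_trans (Im_le_nrm _)) // nrmN.
exists (u +i* v)%C; first by apply/allpairsP; exists (u, v).
have -> : a - (u +i* v)%C = (complex.Re a - u)%:C + 'i%C * (complex.Im a - v)%:C.
  by rewrite [LHS]complexE; case: (a).
apply: le_lt_trans (nrmD _ _) _; rewrite nrmM !nrm_real.
have -> : nrm ('i%C : R[i]) = 1 by rewrite /nrm normc_def /= expr0n expr1n add0r sqrtr1.
by move: hu hv; rewrite mul1r; lra.
Qed.

Lemma totally_bounded_span (C : R) (v : nat -> H) n : totally_bounded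
  [set \sum_(k < n) a k *: v k | a in [set a : nat -> R[i] | forall k, nrm (a k) <= C]].
Proof.
elim: n => [|n IH] e e0.
  exists [:: 0] => x [a _ <-]; exists 0; first by rewrite mem_seq1.
  by rewrite big_ord0 subrr nrm0.
have e2 : 0 < e / 2 by rewrite divr_gt0.
have v1 : 0 < nrm (v n) + 1 by rewrite ltr_wpDl // nrm_ge0.
have [s hs] := IH _ e2.
have [t ht] := complex_net C (divr_gt0 e2 v1).
exists [seq y + b *: v n | y <- s, b <- t] => _ [a aC <-].
have [|y ys hy] := hs (\sum_(k < n) a k *: v k); first by exists a.
have [b bt hb] := ht _ (aC n).
exists (y + b *: v n); first by apply/allpairsP; exists (y, b).
rewrite big_ord_recr /= opprD addrACA -scalerBl.
apply: le_lt_trans (nrmD _ _) _; rewrite nrmZ.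
have h : nrm (a n - b) * nrm (v n) <= e / 2.
  apply: (@le_trans _ _ (nrm (a n - b) * (nrm (v n) + 1))).
    by rewrite ler_wpM2l ?nrm_ge0 // lerDl.
  by rewrite -ler_pdivlMr // ltW.
by move: hy h; lra.
Qed.

(** A finite rank operator close to [T] sends the unit ball to combinations of finitely many vectors
    with bounded coefficients, which have finite nets. The contrapositive provides the lower bound
    [d] on the singular numbers of a non-compact operator. *)
Lemma approximable_compact T : bounded_operator T ->
  (forall e : R, 0 < e -> exists j, snum T j < e) -> compact_operator T.
Proof.
move=> bT h; split=> //; apply: totally_bounded_compact => e e0.
have e2 : 0 < e / 2 by rewrite divr_gt0.
have [j /snum_lt [F [bF dF TF]]] := h _ e2.
have [u [ou hu]] := dim_le_orthosys norm_dot dF.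
have [s hs] := @totally_bounded_span (opnorm F) u j _ e2.
exists s => _ [x x1 <-]; rewrite /= nrm_unit_le in x1.
have [|y ys hy] := hs (F x).
  rewrite -(hu (F x)); last by exists x.
  exists (fun k => dot (F x) (u k)) => // k.
  apply: (le_trans (cauchy_schwarz norm_dot _ _)).
  apply: (@le_trans _ _ (nrm (F x) * 1)).
    by rewrite ler_wpM2l ?nrm_ge0 // (orthosys_le1 (ou k.+1)).
  by rewrite mulr1 (le_trans (le_opnorm _ bF)) // ler_piMr // opnorm_ge0.
exists y => //.
have h1 : nrm (T x - F x) <= opnorm (T \- F).
  have bTF := bounded_sub bT bF.
  have := le_opnorm x bTF; rewrite /= => h2; apply: (le_trans h2).
  by rewrite ler_piMr // opnorm_ge0.
have := nrmB_le (T x) (F x) y; move: h1 TF hy; lra.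
Qed.

End CompactOperators.

(** * Schmidt expansions *)

Section Schmidt.
Variables (R : realType) (H : completeNormedModType R[i]).
Variable dot : {dot H for Num.conj}.
Hypothesis norm_dot : forall x : H, `|x| ^+ 2 = dot x x.
Implicit Types (x y z : H) (a : R[i]) (T K : H -> H) (e f : nat -> H).
Implicit Types (s : nat -> R).

(* [T = \sum_j s_j <., e_j> f_j], stated through the norm of [T] on the
   orthogonal complement of [e_0, ..., e_(n-1)]. *)
Record schmidt_expansion T s e f : Prop := Schmidt {
  sch_e : forall n, orthosys dot n e ;
  sch_f : forall n, orthosys dot n f ;
  sch_ge0 : forall j, 0 <= s j ;
  sch_mono : forall m n, (m <= n)%N -> s n <= s m ;
  sch_apply : forall j, T (e j) = (s j)%:C *: f j ;
  sch_unit : forall j, s j != 0 -> nrm (e j) = 1 /\ nrm (f j) = 1 ;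
  sch_le : forall n x, (forall j, (j < n)%N -> dot x (e j) = 0) ->
    nrm (T x) <= s n * nrm x }.

Lemma closed_orthocomplement (S : set H) :
  closed_subspace [set x | forall y, S y -> dot x y = 0].
Proof.
split=> [x xS y Sy|y _|a x y hx hy z Sz] /=; first last.
- by rewrite dotDl dotZl hx // hy // mulr0 addr0.
- by rewrite dot0l.
apply: nrm_eq0; apply/eqP; rewrite eq_le nrm_ge0 andbT.
apply/ler_addgt0Pr => r r0; rewrite add0r.
have C1 : 0 < nrm y + 1 by rewrite ltr_wpDl // nrm_ge0.
have rC : 0 < r / (nrm y + 1) by rewrite divr_gt0.
have [|x' [hx' xx']] := xS (ball x (r / (nrm y + 1))%:C).
  by apply: nbhsx_ballx; rewrite ltcR.
move: xx'; rewrite -ball_normE /ball_ /= nrmE ltcR ltr_pdivlMr // => xx'.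
rewrite -[dot x y]subr0 -(hx' y Sy) -dotBl.
apply: (le_trans (cauchy_schwarz norm_dot _ _)); apply: le_trans (ltW xx').
by rewrite ler_wpM2l ?nrm_ge0 // lerDl.
Qed.

Lemma schmidt_exists T : compact_operator T -> exists s e f, schmidt_expansion T s e f.
Proof.
move=> cT; have bT := cT.1; have lT := bounded_lin bT.
pose P (s : seq H) x := [/\ forall k, (k < size s)%N -> dot x (nth 0 s k) = 0,
  x = 0 \/ nrm x = 1 &
  forall z, (forall k, (k < size s)%N -> dot z (nth 0 s k) = 0) ->
    nrm (T z) <= nrm (T x) * nrm z].
have [s|e he] := @prefix_choice _ P.
  have [x [xV x1 hx]] := norm_attained norm_dot cT
    (closed_orthocomplement [set y | exists2 k, (k < size s)%N & y = nth 0 s k]).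
  exists x; split=> // [k ks|z hz]; first by apply: xV; exists k.
  by apply: hx => _ [k ks ->]; exact: hz.
have e_perp n k : (k < n)%N -> dot (e n) (e k) = 0.
  move=> kn; have [+ _ _] := he n; rewrite size_mkseq => /(_ k kn).
  by rewrite nth_mkseq.
have e01 n : e n = 0 \/ nrm (e n) = 1 by have [_ + _] := he n.
have e_max n z : (forall k, (k < n)%N -> dot z (e k) = 0) ->
    nrm (T z) <= nrm (T (e n)) * nrm z.
  move=> hz; have [_ _] := he n; rewrite size_mkseq; apply=> k kn.
  by rewrite nth_mkseq // hz.
have oe n : orthosys dot n e.
  elim: n => [|n IH]; first by split.
  by apply: orthosysS => //; exact: e_perp.
(* [e i] maximises over a space that also contains [e j]. Moving it by [a *: e j] changes its
   squared length only at second order, so the first-order change of the image must vanish. *)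
have Te_perp i j : (i < j)%N -> dot (T (e i)) (T (e j)) = 0.
  move=> ij; apply: (@variation_eq0 _ _ (nrm (T (e i)) ^+ 2)) => a.
  have h : nrm (T (e i + a *: e j)) <= nrm (T (e i)) * nrm (e i + a *: e j).
    apply: e_max => k ki; rewrite dotDl dotZl !e_perp ?mulr0 ?addr0 //.
    exact: ltn_trans ij.
  have h2 : nrm (e i + a *: e j) ^+ 2 <= 1 + nrm a ^+ 2.
    rewrite (pythagoras norm_dot); last by rewrite dotZr dotC e_perp // rmorph0 mulr0.
    have u1 k : nrm (e k) ^+ 2 <= 1.
      by rewrite expr_le1 ?nrm_ge0 // (orthosys_le1 (oe k.+1)).
    by rewrite nrmZ exprMn lerD // ler_piMr // sqr_ge0.
  have : nrm (T (e i + a *: e j)) ^+ 2 <= nrm (T (e i)) ^+ 2 * (1 + nrm a ^+ 2).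
    apply: (@le_trans _ _ ((nrm (T (e i)) * nrm (e i + a *: e j)) ^+ 2)).
      by rewrite ler_pXn2r // nnegrE ?mulr_ge0 ?nrm_ge0.
    by rewrite exprMn ler_wpM2l // sqr_ge0.
  rewrite linD // linZ // (nrmD_sq norm_dot) dotZr.
  have := sqr_ge0 (nrm (a *: T (e j))); lra.
pose f j := normalize (T (e j)).
exists (fun j => nrm (T (e j))), e, f; split => //.
- move=> n; split=> [i j _ _ ij|i _]; last exact: normalizeP.
  rewrite /f /normalize dotZl dotZr.
  have [ltij|ltji|//] := ltngtP i j; first by rewrite Te_perp // !mulr0.
  by rewrite dotC Te_perp // rmorph0 !mulr0.
- by move=> j; exact: nrm_ge0.
- move=> m n mn; apply: le_trans (e_max m (e n) _) _.
    by move=> k km; apply: e_perp; exact: leq_trans mn.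
  by rewrite ler_piMr ?nrm_ge0 // (orthosys_le1 (oe n.+1)).
- by move=> j; rewrite normalizeK.
- move=> j Tj; split.
    by have [e0|//] := e01 j; move: Tj; rewrite e0 lin0 // nrm0 eqxx.
  by apply: normalize_neq0 => T0; move: Tj; rewrite T0 nrm0 eqxx.
Qed.

Lemma sch_dot_f T s e f i j : schmidt_expansion T s e f -> i <> j -> dot (f i) (f j) = 0.
Proof.
move=> sch ij; exact: ((sch_f sch (maxn i j).+1).1 _ _ (leq_maxl i j) (leq_maxr i j)).
Qed.

(** If all [s n] were at least [r], the images [T (e n)] would be orthogonal of length at least [r],
    hence too far apart for two of them to lie within [r / 2] of a cluster point. *)
Lemma schmidt_cvg0 T s e f : compact_operator T -> schmidt_expansion T s e f ->
  forall r : R, 0 < r -> exists n, s n < r.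
Proof.
move=> cT sch r r0; apply: contrapT => /forallNP hN.
have {}hN n : r <= s n by rewrite leNgt; apply/negP/hN.
have [|y hy] := compact_seq_cluster cT (z := e).
  by move=> n; exact: (orthosys_le1 (sch_e sch n.+1)).
have r2 : 0 < r / 2 by rewrite divr_gt0.
have [n _ hn] := hy _ 0%N r2; have [m nm hm] := hy _ n.+1 r2.
have lb k : r ^+ 2 <= nrm (T (e k)) ^+ 2.
  have rs := hN k; have s0 : s k != 0 by rewrite gt_eqF // (lt_le_trans r0).
  rewrite (sch_apply sch) nrmZr (sch_unit sch s0).2 mulr1 ger0_norm ?(sch_ge0 sch) //.
  by rewrite ler_pXn2r // nnegrE ?(sch_ge0 sch) // ltW.
have : nrm (T (e n) - T (e m)) ^+ 2 < r ^+ 2.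
  rewrite ltr_pXn2r // ?nnegrE ?nrm_ge0 ?(ltW r0) //.
  have := nrmB_le (T (e n)) y (T (e m)); rewrite (nrm_sub y); move: hn hm; lra.
rewrite (nrmB_sq norm_dot) !(sch_apply sch) dotZl dotZr (sch_dot_f sch); last first.
  by move=> mn; rewrite mn ltnn in nm.
rewrite !mulr0 -!(sch_apply sch) /=; have := lb n; have := lb m.
have := exprn_gt0 2 r0; lra.
Qed.

(** The coordinates of the [n.+1] images form a matrix with [n] columns, which has a nonzero left
    kernel. *)
Lemma kernel_vector n (F : H -> H) (e : nat -> H) :
  linear F -> dim_le n (range F) ->
  exists a : nat -> R[i], (exists2 k, (k < n.+1)%N & a k != 0) /\
    F (\sum_(k < n.+1) a k *: e k) = 0.
Proof.
move=> lF /dim_leP [v hv].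
have /choice [A hA] : forall k, exists b : nat -> R[i],
    F (e k) = \sum_(j < n) b j *: v j by move=> k; apply: hv; exists (e k).
pose M : 'M[R[i]]_(n.+1, n) := \matrix_(k, j) A k j.
have : kermx M != 0.
  rewrite kermx_eq0 /row_free neq_ltn; apply/orP; left.
  by rewrite ltnS rank_leq_col.
case/rowV0Pn => u /sub_kermxP uM u0.
exists (fun k => if insub k is Some i then u 0 i else 0); split.
  have [k uk] : exists k, u 0 k != 0.
    apply: contrapT => /forallNP h; move: u0 => /eqP; apply.
    by apply/rowP => k; rewrite mxE; apply/eqP/negPn/negP/h.
  by exists k => //; rewrite valK.
rewrite lin_sum //.
transitivity (\sum_(j < n) (u *m M) 0 j *: v j); last first.
  by rewrite uM big1 // => j _; rewrite mxE scale0r.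
under eq_bigr => k _ do rewrite valK linZ // hA scaler_sumr.
rewrite exchange_big /=; apply: eq_bigr => j _.
rewrite !mxE scaler_suml; apply: eq_bigr => k _.
by rewrite mxE scalerA.
Qed.

(** Cutting [T] off after [n] vectors gives the upper bound. For the lower one, an [F] with range
    spanned by [n] vectors kills a nonzero combination of [e 0], ..., [e n], which [T] stretches by
    at least [s n]. *)
Lemma schmidt_snum T s e f : bounded_operator T -> schmidt_expansion T s e f -> snum T = s.
Proof.
move=> bT sch; have lT := bounded_lin bT; apply/funext => n.
apply/eqP; rewrite eq_le; apply/andP; split.
  have bE : bounded_operator (fourier dot e n).
    apply: contraction_bounded; first exact: linear_fourier.
    by move=> x; exact: nrm_fourier_le (sch_e sch n) x.
  apply: (le_trans (snum_le bT (F := T \o fourier dot e n) _ _)).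
  - exact: bounded_comp.
  - apply: (@dim_le_image _ _ n T (fourier dot e n) id) => //.
    apply: (orthosys_dim_le (dot := dot) (e := e)) => _ [x _ <-].
    rewrite fourier_sum; apply: eq_bigr => k _.
    by rewrite fourierZ (fourier_basis norm_dot (sch_e sch n)).
  apply: opnorm_le (sch_ge0 sch n) => x; rewrite /= -linB //.
  apply: (le_trans (sch_le sch (n := n) _)).
    by move=> j jn; rewrite (dot_residual norm_dot (sch_e sch n)).
  by rewrite ler_wpM2l ?(sch_ge0 sch) ?(nrm_residual_le norm_dot (sch_e sch n)).
have [->|sn] := eqVneq (s n) 0; first exact: snum_ge0.
have snp : 0 < s n by rewrite lt0r sn (sch_ge0 sch).
apply: snum_ge => F bF dF; have lF := bounded_lin bF.
have [a [[k kn ak] Fx]] := kernel_vector e lF dF; set x := \sum_(k < _) _ in Fx.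
have unit j : (j < n.+1)%N -> nrm (e j) = 1 /\ nrm (f j) = 1.
  move=> jn; apply: (sch_unit sch); rewrite gt_eqF // (lt_le_trans snp) //.
  exact: (sch_mono sch).
have xsq : nrm x ^+ 2 = \sum_(j < n.+1) nrm (a j) ^+ 2.
  rewrite (nrm_sum_orthosys norm_dot (sch_e sch n.+1)); apply: eq_bigr => j _.
  by rewrite (unit j (ltn_ord j)).1 mulr1.
have Txsq : nrm (T x) ^+ 2 = \sum_(j < n.+1) (nrm (a j) * s j) ^+ 2.
  rewrite lin_sum //.
  under eq_bigr => j _ do rewrite linZ // (sch_apply sch) scalerA.
  rewrite (nrm_sum_orthosys norm_dot (sch_f sch n.+1) (fun j => a j * (s j)%:C)).
  apply: eq_bigr => j _.
  by rewrite (unit j (ltn_ord j)).2 mulr1 nrmM nrm_real ger0_norm // (sch_ge0 sch).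
have xp : 0 < nrm x.
  rewrite lt0r nrm_ge0 andbT -sqrf_eq0 xsq gt_eqF //.
  rewrite (bigD1 (Ordinal kn)) //= ltr_pwDl ?sumr_ge0 // => [|i _]; last exact: sqr_ge0.
  rewrite exprn_gt0 // lt0r nrm_ge0 andbT; apply: contra ak => /eqP /nrm_eq0 ->.
  exact: eqxx.
rewrite -(ler_pM2r xp); apply: le_trans (le_opnorm x (bounded_sub bT bF)).
rewrite /= Fx subr0 -(@ler_pXn2r _ 2) ?nnegrE ?mulr_ge0 ?nrm_ge0 ?(ltW snp) //.
rewrite exprMn xsq Txsq mulr_sumr; apply: ler_sum => j _.
rewrite exprMn mulrC ler_wpM2l ?sqr_ge0 // ler_pXn2r ?nnegrE ?(sch_ge0 sch) //.
by apply: (sch_mono sch); rewrite -ltnS.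
Qed.

Lemma schmidt_approx T s e f n x : bounded_operator T -> schmidt_expansion T s e f ->
  nrm (T x - \sum_(k < n) (s k)%:C *: (dot x (e k) *: f k)) <= s n * nrm x.
Proof.
move=> bT sch; have lT := bounded_lin bT.
have -> : \sum_(k < n) (s k)%:C *: (dot x (e k) *: f k) = T (fourier dot e n x).
  rewrite lin_sum //; apply: eq_bigr => k _.
  by rewrite (linZ lT) (sch_apply sch) !scalerA mulrC.
rewrite -linB //; apply: (le_trans (sch_le sch (n := n) _)).
  by move=> j jn; rewrite (dot_residual norm_dot (sch_e sch n)).
by rewrite ler_wpM2l ?(sch_ge0 sch) ?(nrm_residual_le norm_dot (sch_e sch n)).
Qed.

End Schmidt.

(** * Traces *)

Section PartialSums.
Variable R : realType.

Lemma partial_sum_dist (V : normedZmodType R[i]) (u : nat -> V) (b : nat -> R) N n :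
  (forall k, nrm (u k) <= b k) -> (N <= n)%N ->
  nrm (\sum_(k < n) u k - \sum_(k < N) u k) <=
  \sum_(k < n) b k - \sum_(k < N) b k.
Proof.
move=> ub; elim: n => [|n IH]; first by rewrite leqn0 => /eqP ->; rewrite !subrr nrm0.
rewrite leq_eqVlt => /predU1P[->|Nn]; first by rewrite !subrr nrm0.
rewrite !big_ord_recr /= !(addrAC _ _ (- _)); apply: le_trans (nrmD _ _) _.
by rewrite lerD // IH.
Qed.

Lemma series_tail (b : nat -> R) : (forall k, 0 <= b k) -> cvgn (series b) ->
  forall e, 0 < e -> exists N, forall n, \sum_(k < n) b k <= \sum_(k < N) b k + e.
Proof.
move=> b0 cb e e0.
have nd : nondecreasing_seq (series b).
  by apply/nondecreasing_seqP => n; rewrite seriesSr lerDl.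
have /cvgrPdist_le /(_ _ e0) [N _ hN] := cb.
exists N => n; have := nondecreasing_cvgn_le nd cb n; rewrite /series /= big_mkord.
move=> h; apply: (le_trans h); have /= := hN N (leqnn N).
by rewrite /series /= big_mkord => /(le_trans (ler_norm _)); rewrite lerBlDl.
Qed.

Lemma summable_cvg0 (b : nat -> R) : (forall k, 0 <= b k) -> cvgn (series b) ->
  (forall m n, (m <= n)%N -> b n <= b m) ->
  forall e, 0 < e -> exists N, forall n, (N <= n)%N -> b n <= e.
Proof.
move=> b0 cb bm e e0; have [N hN] := series_tail b0 cb e0; exists N => n Nn.
by apply: (le_trans (bm _ _ Nn)); have := hN N.+1; rewrite big_ord_recr /= lerD2l.
Qed.

Lemma bounded_series_cvg (b : nat -> R) (C : R) : (forall k, 0 <= b k) ->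
  (forall n, \sum_(k < n) b k <= C) -> cvgn (series b).
Proof.
move=> b0 bC; apply: nondecreasing_is_cvgn.
  by apply/nondecreasing_seqP => n; rewrite seriesSr lerDl.
by exists C => _ [n _ <-]; rewrite /series /= big_mkord.
Qed.

Lemma summable_cvg (V : completeNormedModType R[i]) (u : nat -> V) (b : nat -> R) :
  (forall k, nrm (u k) <= b k) -> cvgn (series b) ->
  exists l : V, (fun n => \sum_(k < n) u k) @ \oo --> l.
Proof.
move=> ub cb; apply: cauchy_seq_cvg => e e0.
have b0 k : 0 <= b k by exact: le_trans (nrm_ge0 _) (ub k).
have e4 : 0 < e / 4 by rewrite divr_gt0.
have [N hN] := series_tail b0 cb e4.
have h n : (N <= n)%N -> nrm (\sum_(k < n) u k - \sum_(k < N) u k) <= e / 4.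
  move=> Nn; apply: (le_trans (partial_sum_dist ub Nn)).
  by rewrite lerBlDl hN.
exists N => n m /h hn /h hm.
apply: le_lt_trans (nrmB_le _ (\sum_(k < N) u k) _) _.
rewrite (nrm_sub (\sum_(k < N) u k)).
move: (nrm _) (nrm _) hn hm => p q; lra.
Qed.

End PartialSums.

Section Trace.
Variables (R : realType) (H : completeNormedModType R[i]).
Variable dot : {dot H for Num.conj}.
Hypothesis norm_dot : forall x : H, `|x| ^+ 2 = dot x x.
Implicit Types (x y z : H) (a : R[i]) (T K : H -> H) (e f g : nat -> H).
Implicit Types (s : nat -> R).

(** The converse of [schmidt_exists] for summable coefficients, which turns a norming sequence into
    a norming operator. *)
Lemma schmidt_operator s e f : (forall n, orthosys dot n e) ->
  (forall n, orthosys dot n f) -> (forall j, 0 <= s j) ->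
  (forall m n, (m <= n)%N -> s n <= s m) ->
  (forall j, s j != 0 -> nrm (e j) = 1 /\ nrm (f j) = 1) -> cvgn (series s) ->
  exists2 K, bounded_operator K & schmidt_expansion dot K s e f.
Proof.
move=> oe of_ s0 sm s1 cs.
pose S n x := \sum_(k < n) ((s k)%:C * dot x (e k)) *: f k.
have Scvg x : exists y, S ^~ x @ \oo --> y.
  apply: (@summable_cvg R H (fun k => ((s k)%:C * dot x (e k)) *: f k)
    (fun k => nrm x * s k)).
    move=> k; rewrite nrmZ nrmM nrm_real ger0_norm // mulrC.
    rewrite [nrm x * _]mulrC mulrCA ler_wpM2l //.
    rewrite -[leRHS]mulr1 mulrC ler_pM ?nrm_ge0 //; last exact: (orthosys_le1 (of_ k.+1)).
    apply: (le_trans (cauchy_schwarz norm_dot _ _)).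
    by rewrite ler_piMr ?nrm_ge0 // (orthosys_le1 (oe k.+1)).
  rewrite (_ : series _ = (fun n => nrm x * series s n)).
    by apply: is_cvgMr.
  by apply/funext => n; rewrite /series /= mulr_sumr.
have /choice [K hK] := Scvg.
have lS n : linear (S n).
  move=> a x y; rewrite scaler_sumr -big_split; apply: eq_bigr => k _.
  by rewrite /= dotDl dotZl scalerA -scalerDl; congr (_ *: _); ring.
have lK : linear K.
  move=> a x y; have h : S ^~ (a *: x + y) @ \oo --> a *: K x + K y.
    rewrite (_ : S ^~ _ = (fun n => a *: S n x + S n y)); last first.
      by apply/funext => n; exact: lS.
    by apply: cvgD (hK y); apply: cvgZr.
  exact: (cvg_unique _ (hK _) h).
have K_le n x : (forall j, (j < n)%N -> dot x (e j) = 0) ->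
    nrm (K x) <= s n * nrm x.
  move=> hx; apply: (nrm_cvg_le (N := 0%N) (hK x)) => m _.
  apply: nrm_le_sq; first by rewrite mulr_ge0 ?nrm_ge0.
  apply: (le_trans (nrm_sum_le norm_dot (of_ m) (fun k => (s k)%:C * dot x (e k)))).
  rewrite exprMn.
  apply: (@le_trans _ _ (s n ^+ 2 * \sum_(k < m) nrm (dot x (e k)) ^+ 2)).
    rewrite mulr_sumr; apply: ler_sum => k _.
    rewrite nrmM nrm_real ger0_norm // exprMn.
    have [kn|nk] := ltnP k n; first by rewrite hx // nrm0 expr0n !mulr0.
    by rewrite ler_wpM2r ?sqr_ge0 // ler_pXn2r ?nnegrE // sm.
  by rewrite ler_wpM2l ?sqr_ge0 // (bessel norm_dot (oe m)).
exists K.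
  by apply/bounded_operatorP; split=> //; exists (s 0%N) => // x; exact: K_le.
split=> // j.
suff h : S ^~ (e j) @ \oo --> (s j)%:C *: f j by exact: (cvg_unique _ (hK _) h).
apply/cvg_seqP => r r0; exists j.+1 => n jn.
rewrite (_ : S n (e j) = (s j)%:C *: f j) ?subrr ?nrm0 //.
rewrite /S (bigD1 (Ordinal jn)) //= big1 ?addr0.
  have [->|/s1 [e1 _]] := eqVneq (s j) 0; first by rewrite !mul0r.
  by rewrite (dotxx norm_dot) e1 expr1n mulr1.
move=> i ij; rewrite ((oe n).1 _ _ jn (ltn_ord i)) ?mulr0 ?scale0r // => ji.
by move: ij => /eqP; apply; apply/val_inj.
Qed.

Lemma orthonormal_basis_orthosys g n : orthonormal_basis dot g -> orthosys dot n g.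
Proof.
move=> [og _]; split=> [i j _ _ /eqP/negPf ij|i _]; first by rewrite og ij.
right; apply/eqP; rewrite -(@eqrXn2 _ 2) ?nrm_ge0 //.
by rewrite (nrm_sq norm_dot) og eqxx expr1n.
Qed.

(* Exchanging the two sums is justified by the uniform bound
   |<P_n T f_j, e_j>| <= |T|, P_n the projection on the span of g_0, ..., g_(n-1). *)
Lemma schmidt_has_trace T K s e f t : bounded_operator T -> bounded_operator K ->
  schmidt_expansion dot K s e f -> cvgn (series s) ->
  (fun n => \sum_(j < n) (s j)%:C * dot (T (f j)) (e j) : (R[i] : numFieldType))
    @ \oo --> t ->
  has_trace dot (T \o K) t.
Proof.
move=> bT bK sch cs st g og.
have ong n := orthonormal_basis_orthosys n og.
have s0 := sch_ge0 sch; have lT := bounded_lin bT.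
pose C := opnorm T; have C0 : 0 <= C := opnorm_ge0 bT.
(* The double partial sum: [J] Schmidt terms and [n] basis vectors. It tends to [a n] as [J] grows
   and to [D' J] as [n] grows. *)
pose D J n := \sum_(j < J) (s j)%:C * dot (fourier dot g n (T (f j))) (e j).
pose D' J := \sum_(j < J) (s j)%:C * dot (T (f j)) (e j).
pose a n := \sum_(k < n) dot (T (K (g k))) (g k).
have Tf j : nrm (T (f j)) <= C.
  apply: (le_trans (le_opnorm _ bT)).
  by rewrite ler_piMr // (orthosys_le1 (sch_f sch j.+1)).
have dotC_le j x : nrm x <= C -> nrm ((s j)%:C * dot x (e j)) <= C * s j.
  move=> xC; rewrite nrmM nrm_real ger0_norm // mulrC ler_wpM2r //.
  apply: (le_trans (cauchy_schwarz norm_dot _ _)); apply: le_trans xC.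
  by rewrite ler_piMr ?nrm_ge0 // (orthosys_le1 (sch_e sch j.+1)).
have D_le n j := dotC_le j _ (le_trans (nrm_fourier_le norm_dot (ong n) _) (Tf j)).
have D'_le j := dotC_le j _ (Tf j).
have aD J n : nrm (a n - D J n) <= n%:R * (C * s J).
  have -> : D J n =
      \sum_(k < n) dot (T (\sum_(j < J) (s j)%:C *: (dot (g k) (e j) *: f j))) (g k).
    under [RHS]eq_bigr => k _ do rewrite lin_sum // dot_suml.
    rewrite exchange_big /=; apply: eq_bigr => j _.
    rewrite dot_suml mulr_sumr; apply: eq_bigr => k _.
    rewrite !(linZ lT) !dotZl; ring.
  rewrite -sumrB; apply: (le_trans (nrm_sum _ _ _)).
  rewrite mulr_natl -[n in _ *+ n]card_ord -sumr_const; apply: ler_sum => k _.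
  rewrite -dotBl -linB //; apply: (le_trans (cauchy_schwarz norm_dot _ _)).
  have g1 := orthosys_le1 (ong n) (ltn_ord k).
  apply: (@le_trans _ _ (C * (s J * nrm (g k)) * 1)).
    rewrite ler_pM ?nrm_ge0 //; apply: (le_trans (le_opnorm _ bT)).
    by rewrite ler_wpM2l // (schmidt_approx norm_dot).
  by rewrite mulr1 ler_wpM2l // ler_piMr.
have Dcvg J (r : R) : 0 < r -> exists N, forall n, (N <= n)%N -> nrm (D J n - D' J) < r.
  elim: J r => [|J IH] r r0.
    by exists 0%N => n _; rewrite /D /D' !big_ord0 subrr nrm0.
  have r2 : 0 < r / 2 by rewrite divr_gt0.
  have sJ : 0 < s J + 1 by rewrite ltr_wpDl.
  have [N1 h1] := IH _ r2.
  have /cvg_seqP /(_ _ (divr_gt0 r2 sJ)) [N2 h2] := og.2 (T (f J)).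
  exists (maxn N1 N2) => n; rewrite geq_max => /andP[/h1 {}h1 /h2].
  rewrite big_mkord ltr_pdivlMr // => {}h2.
  rewrite /D /D' !big_ord_recr /= opprD addrACA -mulrBr -dotBl.
  apply: le_lt_trans (nrmD _ _) _; rewrite (splitr r); apply: ltr_leD => //.
  rewrite nrmM nrm_real ger0_norm // mulrC.
  apply: le_trans (ltW h2); rewrite ler_pM ?nrm_ge0 ?lerDl //.
  apply: (le_trans (cauchy_schwarz norm_dot _ _)).
  by rewrite ler_piMr ?nrm_ge0 // (orthosys_le1 (sch_e sch J.+1)).
apply/(@cvg_seqP R (R[i] : numFieldType)) => r r0.
(* The three errors add up to less than [2 * C * d + 2 * d]; the denominator stays positive even
   when [C] is zero. *)
pose d := r / (3 * C + 3).
have C3 : 0 < 3 * C + 3 by lra.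
have dp : 0 < d by rewrite divr_gt0.
have [J hJ] := series_tail s0 cs dp.
have tail (u : nat -> R[i]) n : (forall j, nrm (u j) <= C * s j) -> (J <= n)%N ->
    nrm (\sum_(j < n) u j - \sum_(j < J) u j) <= C * d.
  move=> hu Jn; apply: (le_trans (partial_sum_dist hu Jn)).
  by rewrite -!mulr_sumr -mulrBr ler_wpM2l // lerBlDl.
have tD' : nrm (t - D' J) <= C * d.
  apply/ler_addgt0Pr => q q0.
  have /(@cvg_seqP R (R[i] : numFieldType)) /(_ _ q0) [N hN] := st.
  have h1 := hN _ (leq_maxl N J); have h2 := tail _ _ D'_le (leq_maxr N J).
  apply: (le_trans (nrmB_le _ (D' (maxn N J)) _)); rewrite addrC lerD //.
  by rewrite nrm_sub; exact: ltW.
(* The bound [aD] grows with [n], so it is used at some [J'] depending on [n]; passing from [J']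
   back to [J] costs [C * d], uniformly in [n]. *)
have aDJ n : nrm (a n - D J n) <= C * d + d.
  have n1 : 0 < n.+1%:R * (C + 1) by rewrite mulr_gt0 // ltr_wpDl.
  have [N hN] := summable_cvg0 s0 cs (sch_mono sch) (divr_gt0 dp n1).
  pose J' := maxn N J; have := hN J' (leq_maxl _ _).
  rewrite ler_pdivlMr // => hs.
  have h1 : nrm (a n - D J' n) <= d.
    apply: (le_trans (aD J' n)); apply: le_trans hs.
    rewrite mulrA mulrC ler_wpM2l // ler_pM // ?ler_nat // lerDl ler01 //.
  have h2 := tail _ _ (D_le n) (leq_maxr N J).
  apply: (le_trans (nrmB_le _ (D J' n) _)); rewrite addrC; exact: lerD.
have [N hN] := Dcvg J _ dp.
exists N => n /hN hn; rewrite big_mkord -/(a n).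
have h1 := nrmB_le (a n) (D J n) t.
have h2 := nrmB_le (D J n) (D' J) t.
have h3 : r = 3 * (C * d) + 3 * d.
  by rewrite /d; field; rewrite gt_eqF.
have h4 := aDJ n; rewrite nrm_sub in tD'.
have Cd : 0 <= C * d by rewrite mulr_ge0 // ltW.
move: (nrm (a n - t)) (nrm (a n - D J n)) (nrm (D J n - t)) (nrm (D J n - D' J))
  (nrm (D' J - t)) h1 h2 h4 tD' hn h3 Cd => p1 p2 p3 p4 p5; lra.
Qed.

(** [has_trace] quantifies over all orthonormal bases, so uniqueness of its value rests on the
    existence of one. *)
Lemma trace_eq A t : @separable_space R H -> infinite_dimensional H ->
  has_trace dot A t -> trace dot A = t.
Proof.
move=> sH iH At; have [g og] := exists_orthonormal_basis norm_dot sH iH.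
rewrite /trace; case: xgetP => [u _ Au|/(_ t)]; last by [].
exact: (cvg_unique _ (Au g og) (At g og)).
Qed.

Lemma unit_vector : infinite_dimensional H -> exists u : H, nrm u = 1.
Proof.
move=> iH; apply: contrapT => /forallNP h; apply: (iH 0%N).
exists (fun=> 0) => x _; exists (fun=> 0); rewrite big_ord0.
apply: contrapT => x0; exact: (h (normalize x) (normalize_neq0 x0)).
Qed.

Lemma schmidt_trace_ex T K s e f : infinite_dimensional H -> bounded_operator T ->
  schmidt_expansion dot K s e f -> cvgn (series s) -> exists t : (R[i] : numFieldType),
  (fun n => \sum_(j < n) (s j)%:C * dot (T (f j)) (e j) : (R[i] : numFieldType))
    @ \oo --> t.
Proof.
(* R[i] carries no complete structure in the library, but a line in H does. *)
move=> iH bT sch cs.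
have [u u1] := unit_vector iH.
pose c j := (s j)%:C * dot (T (f j)) (e j).
have [j||l hl] := @summable_cvg R H (fun j => c j *: u) (fun j => opnorm T * s j).
- rewrite nrmZ u1 mulr1 nrmM nrm_real ger0_norm ?(sch_ge0 sch) // mulrC.
  rewrite ler_wpM2r ?(sch_ge0 sch) //.
  apply: (le_trans (cauchy_schwarz norm_dot _ _)).
  have f1 := orthosys_le1 (sch_f sch j.+1) (ltnSn j).
  have e1 := orthosys_le1 (sch_e sch j.+1) (ltnSn j).
  apply: (@le_trans _ _ (nrm (T (f j)))); first by rewrite ler_piMr ?nrm_ge0.
  by apply: (le_trans (le_opnorm _ bT)); rewrite ler_piMr // opnorm_ge0.
- rewrite (_ : series _ = (fun n => opnorm T * series s n)).
    by apply: is_cvgMr.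
  by apply/funext => n; rewrite /series /= mulr_sumr.
exists (dot l u); have := cvg_dotl norm_dot (y := u) hl.
have -> : (fun n => dot (\sum_(k < n) c k *: u) u) = (fun n => \sum_(k < n) c k).
  apply/funext => n; rewrite dot_suml; apply: eq_bigr => j _.
  by rewrite dotZl (dotxx norm_dot) u1 expr1n mulr1.
by [].
Qed.

End Trace.

(** * The Ky Fan inequality *)

Lemma summation_by_parts (F : comNzRingType) (k t : nat -> F) n :
  \sum_(j < n) k j * t j =
  \sum_(j < n) (k j - k j.+1) * \sum_(i < j.+1) t i + k n * \sum_(i < n) t i.
Proof.
elim: n => [|n IH]; first by rewrite !big_ord0 mulr0 addr0.
by rewrite !big_ord_recr /= IH; ring.
Qed.

(** Ky Fan controls partial sums, not single terms; summation by parts transfers such control to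
    sums with nonincreasing nonnegative coefficients. *)
Lemma abel_le (R : realType) (k s : nat -> R) (t : nat -> R[i]) n :
  (forall j, 0 <= k j) -> (forall j, k j.+1 <= k j) ->
  (forall m, (m <= n)%N -> nrm (\sum_(j < m) t j) <= \sum_(j < m) s j) ->
  nrm (\sum_(j < n) (k j)%:C * t j) <= \sum_(j < n) k j * s j.
Proof.
move=> k0 km h; rewrite (summation_by_parts (fun j => (k j)%:C)).
rewrite (summation_by_parts k); apply: le_trans (nrmD _ _) _; apply: lerD.
  apply: le_trans (nrm_sum _ _ _) _; apply: ler_sum => j _.
  rewrite -rmorphB /= nrmM nrm_real ger0_norm ?subr_ge0 //.
  by rewrite ler_wpM2l ?subr_ge0 // h.
by rewrite nrmM nrm_real ger0_norm // ler_wpM2l // h.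
Qed.

Section KyFan.
Variables (R : realType) (H : completeNormedModType R[i]).
Variable dot : {dot H for Num.conj}.
Hypothesis norm_dot : forall x : H, `|x| ^+ 2 = dot x x.

Lemma finite_rank_compact (A : H -> H) n : bounded_operator A ->
  dim_le n (range A) -> compact_operator A /\ snum A n = 0.
Proof.
move=> bA dA; have sA : snum A n = 0.
  apply/eqP; rewrite eq_le snum_ge0 // andbT; apply: (le_trans (snum_le bA bA dA)).
  by apply: opnorm_le => // x; rewrite /= subrr nrm0 mul0r.
split=> //; apply: (approximable_compact norm_dot) => // e e0.
by exists n; rewrite sA.
Qed.

(** The compression [A] has the same entries on the two systems and a Schmidt expansion of only [n]
    terms. By [bessel2] each [a k] enters with a factor of modulus at most 1, and compressing does
    not increase singular numbers. *)
Lemma ky_fan (T : H -> H) n (e f : nat -> H) : bounded_operator T ->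
  orthosys dot n e -> orthosys dot n f ->
  nrm (\sum_(j < n) dot (T (f j)) (e j)) <= \sum_(j < n) snum T j.
Proof.
move=> bT oe of_.
pose E := fourier dot e n; pose F := fourier dot f n.
have cE x : nrm (E x) <= nrm x by exact: nrm_fourier_le.
have cF x : nrm (F x) <= nrm x by exact: nrm_fourier_le.
have lE : linear E by exact: linear_fourier.
have lF : linear F by exact: linear_fourier.
have bE := contraction_bounded lE cE; have bF := contraction_bounded lF cF.
pose A := E \o T \o F.
have bA : bounded_operator A by exact/bounded_comp/bF/bounded_comp.
have dA : dim_le n (range A).
  apply: (orthosys_dim_le (dot := dot) (e := e)) => _ [x _ <-].
  rewrite /A /= {2}/E fourier_sum; apply: eq_bigr => k _.
  by rewrite fourierZ (fourier_basis norm_dot oe).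
have [cA sA] := finite_rank_compact bA dA.
have [a [u [v sch]]] := schmidt_exists norm_dot cA.
have aE := schmidt_snum norm_dot bA sch.
have Ax x : A x = \sum_(k < n) (a k)%:C *: (dot x (u k) *: v k).
  apply/eqP; rewrite -subr_eq0; apply/eqP/nrm_eq0/eqP; rewrite eq_le nrm_ge0 andbT.
  by apply: (le_trans (schmidt_approx norm_dot n x bA sch)); rewrite -aE sA mul0r.
have -> : \sum_(j < n) dot (T (f j)) (e j) =
    \sum_(k < n) (a k)%:C * \sum_(j < n) dot (v k) (e j) * dot (f j) (u k).
  transitivity (\sum_(j < n) dot (A (f j)) (e j)).
    apply: eq_bigr => j _.
    by rewrite /A /= /F (fourier_basis norm_dot of_) // /E (dot_fourier norm_dot oe).
  under eq_bigr => j _ do rewrite Ax dot_suml.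
  rewrite exchange_big /=; apply: eq_bigr => k _.
  by rewrite mulr_sumr; apply: eq_bigr => j _; rewrite !dotZl; ring.
apply: (le_trans (nrm_sum _ _ _)); apply: ler_sum => k _.
rewrite nrmM nrm_real ger0_norm ?(sch_ge0 sch) //.
apply: (@le_trans _ _ (a k)).
  rewrite ler_piMr ?(sch_ge0 sch) //.
  apply: (le_trans (bessel2 norm_dot (v k) (u k) oe of_)).
  rewrite -[leRHS]mulr1 ler_pM ?nrm_ge0 //.
    exact: (orthosys_le1 (sch_f sch k.+1)).
  exact: (orthosys_le1 (sch_e sch k.+1)).
by rewrite -aE; exact: snum_contraction.
Qed.

End KyFan.

(** * Symmetric norming functions on sequences *)

Section Sequences.
Variable R : realType.
Implicit Types (s xi eta : R ^nat) (Phi : R ^nat -> R).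

Definition trunc s n : R ^nat := fun k => if (k < n)%N then s k else 0.

Lemma nth_mkseq_trunc s n : nth 0 (mkseq s n) = trunc s n.
Proof.
apply/funext => k; rewrite /trunc; case: ltnP => kn; first by rewrite nth_mkseq.
by rewrite nth_default // size_mkseq.
Qed.

Lemma c00_trunc s n : c00 (trunc s n).
Proof. by exists n => k nk; rewrite /trunc ltnNge nk. Qed.

Lemma c00_truncE xi : c00 xi -> exists n, xi = trunc xi n.
Proof.
move=> [n hn]; exists n; apply/funext => k; rewrite /trunc.
by case: ltnP => // /hn.
Qed.

Lemma c00_star_trunc s n : (forall j, 0 <= s j) ->
  (forall i j, (i <= j)%N -> s j <= s i) -> c00_star (trunc s n).
Proof.
move=> s0 sm; split; first exact: c00_trunc.
  move=> i j ij; rewrite /trunc; case: ltnP => jn.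
    by rewrite (leq_ltn_trans ij jn); exact: sm.
  by case: ifP.
by move=> k; rewrite /trunc; case: ifP.
Qed.

Lemma fsum_finite (F : R ^nat) n : (forall k, (n <= k)%N -> F k = 0) ->
  \sum_(k \in [set: nat]) F k = \sum_(k < n) F k.
Proof.
move=> F0; rewrite fsbig_ord; symmetry; apply: fsbig_widen => // k /= [_ /negP].
by rewrite -leqNgt => /F0.
Qed.

Lemma snf_max_trunc s n : snf_max (trunc s n) = \sum_(k < n) `|s k|.
Proof.
rewrite /snf_max (@fsum_finite _ n) => [|k nk]; last by rewrite /trunc ltnNge nk normr0.
by apply: eq_bigr => k _; rewrite /trunc ltn_ord.
Qed.

(** One ultrafilter on the indices makes all coordinates converge at once, in place of a diagonal
    argument. *)
Lemma pointwise_cluster (x : nat -> R ^nat) (C : R) :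
  (forall n k, 0 <= x n k <= C) -> exists y : R ^nat,
  forall m N (e : R), 0 < e -> exists2 n, (N <= n)%N &
    forall k, (k < m)%N -> `|x n k - y k| < e.
Proof.
move=> hx; have [U [UU oU]] := ultraFilterLemma (eventually_filter : ProperFilter \oo).
have /choice [y hy] : forall k, exists l : R,
    forall e, 0 < e -> U [set n | `|x n k - l| < e].
  move=> k; have [|l [_ hl]] := @segment_compact R 0 C ((fun n => x n k) @ U) _.
    apply: (@filterE _ U _ ((fun n => x n k) @^-1` `[0, C])) => n.
    by rewrite /= in_itv /=; exact: hx.
  exists l => e e0.
  have [//|h] := in_ultra_setVsetC [set n | `|x n k - l| < e] UU.
  pose S := [set x n k | n in ~` [set n | `|x n k - l| < e]].
  have US : U ((fun n => x n k) @^-1` S) by apply: filterS h => n hn; exists n.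
  have [|_ [[n hn <-]]] := hl S (ball l e) US; first exact: nbhsx_ballx.
  by rewrite -ball_normE /ball_ /= distrC => /hn.
exists y => m N e e0.
have hm : U [set n | forall k, (k < m)%N -> `|x n k - y k| < e].
  elim: m => [|m IH]; first by apply: filterE.
  apply: filterS (filterI IH (hy m e e0)) => n [h1 h2] k; rewrite ltnS leq_eqVlt.
  by move=> /predU1P[->|/h1].
have hN : U [set n | (N <= n)%N] by apply: oU; exists N.
have [n [h1 h2]] := filter_ex (filterI hN hm).
by exists n.
Qed.

Definition snf_seq Phi s : R := sup (range (fun n => Phi (trunc s n))).

Lemma snf_normE (H : completeNormedModType R[i]) Phi (T : H -> H) :
  snf_norm Phi T = snf_seq Phi (snum T).
Proof.
rewrite /snf_norm /snf_seq; congr (sup (_ @` _)).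
by apply/funext => n; rewrite nth_mkseq_trunc.
Qed.

Section NormingFunction.
Variable Phi : R ^nat -> R.
Hypotheses (snPhi : snfunction Phi) (eqPhi : snf_equiv Phi (@snf_max R)).

Lemma snf0 : Phi (fun=> 0) = 0.
Proof.
have c0 : c00 (fun=> 0 : R) by exists 0%N.
transitivity (Phi (fun=> 0 * 0)); first by rewrite mulr0.
by rewrite (snfZ snPhi 0 c0) normr0 mul0r.
Qed.

Lemma snf_lower : exists2 C : R, 0 < C &
  forall s n, \sum_(k < n) `|s k| <= C * Phi (trunc s n).
Proof.
have [_ [C hC]] := eqPhi; exists (`|C| + 1); first by rewrite ltr_wpDl.
move=> s n; rewrite -snf_max_trunc.
have [->|/eqP nz] := eqVneq (trunc s n) (fun=> 0).
  rewrite snf0 mulr0 /snf_max (@fsum_finite _ 0) ?big_ord0 // => k _.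
  by rewrite normr0.
have Pp : 0 < Phi (trunc s n).
  rewrite lt0r (snf_ge0 snPhi) ?andbT; last exact: c00_trunc.
  by apply/eqP => /(snf_eq0 snPhi (c00_trunc s n)).
rewrite -ler_pdivrMr //; apply: (@le_trans _ _ C).
  by apply: hC; exists (trunc s n) => //; split=> //; exact: c00_trunc.
by rewrite (le_trans (ler_norm C)) // lerDl.
Qed.

Lemma snf_upper : exists2 C : R, 0 < C &
  forall s n, Phi (trunc s n) <= C * \sum_(k < n) `|s k|.
Proof.
have [[C hC] _] := eqPhi; exists (`|C| + 1); first by rewrite ltr_wpDl.
move=> s n; rewrite -snf_max_trunc.
have [->|/eqP nz] := eqVneq (trunc s n) (fun=> 0).
  rewrite snf0 /snf_max (@fsum_finite _ 0) ?big_ord0 ?mulr0 // => k _.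
  by rewrite normr0.
have Pp : 0 < snf_max (trunc s n).
  rewrite snf_max_trunc lt0r sumr_ge0 ?andbT //.
  apply/eqP => h; apply: nz; apply/funext => k; rewrite /trunc; case: ltnP => // kn.
  apply/normr0_eq0/eqP; rewrite eq_le normr_ge0 andbT -h.
  by rewrite (bigD1 (Ordinal kn)) //= lerDl sumr_ge0.
rewrite -ler_pdivrMr //; apply: (@le_trans _ _ C).
  by apply: hC; exists (trunc s n) => //; split=> //; exact: c00_trunc.
by rewrite (le_trans (ler_norm C)) // lerDl.
Qed.

(* Truncation averages xi with the sequence whose tail has the opposite sign. *)
Lemma snf_trunc_le xi n : c00 xi -> Phi (trunc xi n) <= Phi xi.
Proof.
move=> cxi; have [N xiN] := c00_truncE cxi.
pose xi' k := if (k < n)%N then xi k else - xi k.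
have cxi' : c00 xi'.
  by have [m hm] := cxi; exists m => k /hm; rewrite /xi' => ->; rewrite oppr0 if_same.
have same : Phi xi' = Phi xi.
  have xi'N : xi' = trunc xi' N.
    apply/funext => k; rewrite /trunc; case: ltnP => // Nk.
    have xk : xi k = 0 by rewrite xiN /trunc ltnNge Nk.
    by rewrite /xi' xk oppr0 if_same.
  rewrite xi'N [in RHS]xiN -!nth_mkseq_trunc.
  rewrite (snf_sym snPhi (perm_refl _)) [RHS](snf_sym snPhi (perm_refl _)).
  rewrite -!map_comp; congr (Phi (nth 0 _)); apply: eq_map => k /=.
  by rewrite /xi'; case: ifP => // _; rewrite normrN.
have -> : trunc xi n = fun k => 2^-1 * (xi k + xi' k).
  apply/funext => k; rewrite /trunc /xi'; case: ifP => _; last by rewrite subrr mulr0.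
  by field.
have cs : c00 (fun k => xi k + xi' k).
  have [m1 h1] := cxi; have [m2 h2] := cxi'; exists (maxn m1 m2) => k.
  by rewrite geq_max => /andP[/h1 -> /h2 ->]; rewrite addr0.
rewrite (snfZ snPhi) // ger0_norm ?invr_ge0 //.
have := snfD snPhi cxi cxi'; rewrite same; lra.
Qed.

Section Adjoint.
Variable s : R ^nat.
Hypotheses (s0 : forall j, 0 <= s j) (sm : forall i j, (i <= j)%N -> s j <= s i).

Lemma snf_adjoint_trunc n : snf_adjoint Phi (trunc s n) =
  sup [set \sum_(k < n) s k * xi k | xi in [set xi | c00_star xi /\ Phi xi = 1]].
Proof.
rewrite /snf_adjoint; congr sup; apply: eq_imagel => xi _.
rewrite (@fsum_finite _ n) => [|k nk]; last by rewrite /trunc ltnNge nk mul0r.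
by apply: eq_bigr => k _; rewrite /trunc ltn_ord.
Qed.

Lemma c00_star_sum : exists2 C : R, 0 < C &
  forall xi m, c00_star xi -> \sum_(k < m) xi k <= C * Phi xi.
Proof.
have [C C0 hC] := snf_lower; exists C => // xi m [cxi _ xi0].
rewrite (eq_bigr (fun k : 'I_m => `|xi k|)) => [|k _]; last by rewrite ger0_norm.
apply: (le_trans (hC _ _)); rewrite ler_wpM2l ?(ltW C0) //.
exact: snf_trunc_le.
Qed.

(** A bound uniform in [n], so that the suprema in [snf_adjoint] and in [snf_seq] are genuine rather
    than default values. *)
Lemma snf_adjoint_bound : exists2 C : R, 0 < C & forall n, ubound
  [set \sum_(k < n) s k * xi k | xi in [set xi | c00_star xi /\ Phi xi = 1]] C.
Proof.
have [C C0 hC] := c00_star_sum; exists ((s 0%N + 1) * C).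
  by rewrite mulr_gt0 // ltr_wpDl.
move=> n _ [xi [cxi P1] <-]; have [_ _ xi0] := cxi.
apply: (@le_trans _ _ (\sum_(k < n) (s 0%N + 1) * xi k)).
  by apply: ler_sum => k _; rewrite ler_wpM2r // (le_trans (sm (leq0n k))) // lerDl.
rewrite -mulr_sumr ler_wpM2l ?addr_ge0 //.
by apply: (le_trans (hC _ n cxi)); rewrite P1 mulr1.
Qed.

Lemma snf_adjoint_ge n xi : c00_star xi -> Phi xi = 1 ->
  \sum_(k < n) s k * xi k <= snf_adjoint Phi (trunc s n).
Proof.
move=> cxi P1; rewrite snf_adjoint_trunc; have [C _ hC] := snf_adjoint_bound.
by apply: ub_le_sup; [exists C; exact: hC|exists xi].
Qed.

Lemma delta_c00_star : c00_star (nth 0 [:: 1 : R]).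
Proof.
split; first by exists 1%N => -[|[|k]].
  by move=> [|[|i]] [|[|j]] //=.
by move=> [|[|k]].
Qed.

Lemma snf_adjoint_le n (C : R) : (forall xi, c00_star xi -> Phi xi = 1 ->
  \sum_(k < n) s k * xi k <= C) -> snf_adjoint Phi (trunc s n) <= C.
Proof.
move=> h; rewrite snf_adjoint_trunc; apply: ge_sup.
  exists (\sum_(k < n) s k * nth 0 [:: 1] k), (nth 0 [:: 1]) => //.
  by split; [exact: delta_c00_star|exact: snf1 snPhi].
by move=> _ [xi [cxi P1] <-]; exact: h.
Qed.

Lemma snf_seq_adjoint_ge n :
  snf_adjoint Phi (trunc s n) <= snf_seq (snf_adjoint Phi) s.
Proof.
have [C _ hC] := snf_adjoint_bound.
apply: ub_le_sup; last by exists n.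
exists C => _ [m _ <-]; apply: snf_adjoint_le => xi cxi P1.
by apply: (hC m); exists xi.
Qed.

Lemma snf_holder n xi : c00_star xi ->
  \sum_(k < n) s k * xi k <= snf_seq (snf_adjoint Phi) s * Phi xi.
Proof.
move=> cxi; have [c xim xi0] := cxi.
have [P0|Pn] := eqVneq (Phi xi) 0.
  rewrite P0 mulr0 big1 // => k _; by rewrite (snf_eq0 snPhi c P0) mulr0.
have Pp : 0 < Phi xi by rewrite lt0r Pn (snf_ge0 snPhi).
rewrite -ler_pdivrMr //; apply: le_trans (snf_seq_adjoint_ge n).
have -> : (\sum_(k < n) s k * xi k) / Phi xi =
    \sum_(k < n) s k * ((Phi xi)^-1 * xi k).
  by rewrite mulr_suml; apply: eq_bigr => k _; ring.
apply: (@snf_adjoint_ge n (fun k => (Phi xi)^-1 * xi k)); last first.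
  by rewrite (snfZ snPhi) // ger0_norm ?invr_ge0 ?(ltW Pp) // mulVf.
split.
- by have [m hm] := c; exists m => k /hm ->; rewrite mulr0.
- by move=> i j ij; rewrite ler_wpM2l ?invr_ge0 ?(ltW Pp) //; exact: xim.
- by move=> k; rewrite mulr_ge0 // invr_ge0 ltW.
Qed.

End Adjoint.
End NormingFunction.
End Sequences.

(** * Norming sequences and Lorentz norms *)

Section NormingSequence.
Variables (R : realType) (Phi : R ^nat -> R).
Hypotheses (snPhi : snfunction Phi) (eqPhi : snf_equiv Phi (@snf_max R)).
Variable s : R ^nat.
Hypotheses (s0 : forall j, 0 <= s j) (sm : forall i j, (i <= j)%N -> s j <= s i).

Lemma snf_seq_adjoint_approx (e : R) : 0 < e -> exists n xi,
  [/\ c00_star xi, Phi xi = 1 &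
      snf_seq (snf_adjoint Phi) s - e < \sum_(k < n) s k * xi k].
Proof.
move=> e0; set L := snf_seq _ _.
have : L - e < L by rewrite ltrBlDr ltrDl.
move=> /sup_gt [|_ [n _ <-]]; first by exists (snf_adjoint Phi (trunc s 0)), 0%N.
rewrite (snf_adjoint_trunc Phi s n) => /sup_gt [|_ [xi [cxi P1] <-] h].
  exists (\sum_(k < n) s k * nth 0 [:: 1] k), (nth 0 [:: 1]) => //.
  by split; [exact: delta_c00_star|exact: snf1 snPhi].
by exists n, xi.
Qed.

(** Mass of the near-maximisers may escape to infinity, but beyond [J] it pairs with coefficients at
    most [s J] and totals at most [C]; hence the loss [s J * C]. *)
Lemma near_maximizer_limit (C : R) :
  (forall xi m, c00_star xi -> \sum_(k < m) xi k <= C * Phi xi) -> 0 < C ->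
  exists y : R ^nat, [/\ forall k, 0 <= y k,
    forall i j, (i <= j)%N -> y j <= y i,
    forall m, \sum_(k < m) y k <= C,
    forall m, Phi (trunc y m) <= 1 &
    forall J, snf_seq (snf_adjoint Phi) s - s J * C <= \sum_(k < J) s k * y k].
Proof.
move=> hC C0; set L := snf_seq _ _.
have /choice [N hN] : forall n : nat, exists N, exists xi, [/\ c00_star xi,
    Phi xi = 1 & L - n.+1%:R^-1 < \sum_(k < N) s k * xi k].
  by move=> n; apply: snf_seq_adjoint_approx; rewrite invr_gt0.
have /choice [x hx] := hN.
have xC n m : \sum_(k < m) x n k <= C.
  by have [cx P1 _] := hx n; have := hC _ m cx; rewrite P1 mulr1.
have x_ge0 n k : 0 <= x n k by have [[_ _ ->]] := hx n.
have xCk n k : 0 <= x n k <= C.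
  rewrite x_ge0 /=; apply: le_trans (xC n k.+1).
  by rewrite big_ord_recr /= lerDr sumr_ge0.
have [y hy] := pointwise_cluster xCk; exists y.
have small (a b c : R) : 0 < c -> (forall e, 0 < e -> a <= b + c * e) -> a <= b.
  move=> c0 h; apply/ler_addgt0Pr => e e0; have := h _ (divr_gt0 e0 c0).
  by rewrite mulrCA divff ?mulr1 // gt_eqF.
have y_ge0 k : 0 <= y k.
  apply/ler_addgt0Pr => e e0; have [n _ /(_ k (ltnSn k))] := hy k.+1 0%N e e0.
  by rewrite ltr_norml => /andP[]; have := x_ge0 n k; lra.
split=> //.
- move=> i j ij; apply: (small _ _ 2) => // e e0.
  have [n _ h] := hy j.+1 0%N e e0.
  have := h i ij; have := h j (ltnSn j); rewrite !ltr_norml => /andP[h1 h2] /andP[h3 h4].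
  have [[_ xm _] _ _] := hx n; have /= := xm i j ij; lra.
- move=> m; apply: (small _ _ (m%:R + 1)); first by rewrite ltr_wpDl.
  move=> e e0; have [n _ h] := hy m 0%N e e0.
  apply: (@le_trans _ _ (\sum_(k < m) (x n k + e))).
    apply: ler_sum => k _; have := h k (ltn_ord k); rewrite ltr_norml => /andP[]; lra.
  rewrite big_split /= sumr_const card_ord mulrDl mul1r mulr_natl.
  by rewrite lerD ?xC // lerDl ltW.
- move=> m; have [D D0 hD] := snf_upper snPhi eqPhi.
  apply: (small _ _ (D * (m%:R + 1))); first by rewrite mulr_gt0 // ltr_wpDl.
  move=> e e0; have [n _ h] := hy m 0%N e e0; have [cx P1 _] := hx n.
  (* The first part has norm at most [Phi (x n) = 1]; the second is small in the maximal norm, hence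
     in [Phi] by equivalence. *)
  have -> : trunc y m = fun k => trunc (x n) m k + trunc (fun k => y k - x n k) m k.
    by apply/funext => k; rewrite /trunc; case: ifP => _; rewrite ?addr0 // addrC subrK.
  apply: (le_trans (snfD snPhi (c00_trunc _ _) (c00_trunc _ _))); apply: lerD.
    by rewrite -P1; have [c _ _] := cx; exact: snf_trunc_le.
  apply: (le_trans (hD _ _)); rewrite -mulrA ler_wpM2l ?(ltW D0) //.
  apply: (@le_trans _ _ (\sum_(k < m) e)).
    by apply: ler_sum => k _; rewrite distrC ltW // h.
  by rewrite sumr_const card_ord mulrDl mul1r mulr_natl lerDl ltW.
- move=> J; pose S := \sum_(k < J) s k.
  have S0 : 0 <= S by rewrite sumr_ge0.
  rewrite lerBlDr; apply: (small _ _ (S + 1)); first by rewrite ltr_wpDl.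
  move=> e e0; have [M hM] := eventually_inv_lt e0.
  have [n /hM hn h] := hy J M e e0; have [_ _ hL] := hx n.
  have h1 : \sum_(k < N n) s k * x n k <= \sum_(k < J) s k * x n k + s J * C.
    pose m := maxn (N n) J.
    have split_ k : s k * x n k <= (if (k < J)%N then s k * x n k else 0) + s J * x n k.
      case: ltnP => kJ; first by rewrite lerDl mulr_ge0.
      by rewrite add0r ler_wpM2r // sm.
    apply: (@le_trans _ _ (\sum_(k < m) s k * x n k)).
      rewrite (big_ord_widen m (fun k => s k * x n k)) ?leq_maxl // big_mkcond /=.
      by apply: ler_sum => k _; case: ifP => // _; rewrite mulr_ge0.
    apply: (le_trans (ler_sum _ (fun (k : 'I_m) _ => split_ k))).
    rewrite big_split /= -mulr_sumr; apply: lerD; last by rewrite ler_wpM2l ?xC.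
    rewrite -big_mkcond /= (big_ord_widen m (fun k => s k * x n k)) //.
    exact: leq_maxr.
  have h2 : \sum_(k < J) s k * x n k <= \sum_(k < J) s k * y k + S * e.
    rewrite mulr_suml -big_split /=; apply: ler_sum => k _.
    rewrite -mulrDr ler_wpM2l //; have := h k (ltn_ord k).
    by rewrite ltr_norml => /andP[]; lra.
  move: hn hL h1 h2; move: (n.+1%:R^-1) (\sum_(k < N n) _) (\sum_(k < J) s k * x n k)
    (\sum_(k < J) s k * y k) (s J * C) => u v p q r; lra.
Qed.

(** Clearing the limit [y] where [s] vanishes leaves the pairing unchanged and ensures that nonzero
    coefficients meet unit Schmidt vectors. *)
Lemma norming_sequence : 0 < s 0%N -> (forall e, 0 < e -> exists n, s n < e) ->
  exists xi : R ^nat, [/\ forall k, 0 <= xi k,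
    forall i j, (i <= j)%N -> xi j <= xi i,
    (forall k, s k = 0 -> xi k = 0) /\ cvgn (series xi),
    snf_seq Phi xi = 1 &
    forall e, 0 < e -> exists N, forall n, (N <= n)%N ->
      `|\sum_(k < n) s k * xi k - snf_seq (snf_adjoint Phi) s| <= e].
Proof.
move=> sp scvg; have [C C0 hC] := c00_star_sum snPhi eqPhi.
have [y [y0 ym yC yP yL]] := near_maximizer_limit hC C0.
set L := snf_seq _ _ in yL *.
have Lp : 0 < L.
  apply: (lt_le_trans sp); apply: le_trans (snf_seq_adjoint_ge snPhi eqPhi s0 sm 1).
  have := snf_adjoint_ge snPhi eqPhi s0 sm 1 (delta_c00_star R) (snf1 snPhi).
  by rewrite big_ord1 /= mulr1.
pose xi k := if s k == 0 then 0 else y k.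
have xi0 k : 0 <= xi k by rewrite /xi; case: ifP.
have xim i j : (i <= j)%N -> xi j <= xi i.
  move=> ij; rewrite /xi; have [si|si] := eqVneq (s i) 0.
    by rewrite ifT // eq_le s0 andbT -si sm.
  by case: ifP => // _; exact: ym.
have sxi n : \sum_(k < n) s k * xi k = \sum_(k < n) s k * y k.
  by apply: eq_bigr => k _; rewrite /xi; case: eqP => // ->; rewrite !mul0r.
(* As [s] is nonincreasing and nonnegative, its zeros form a tail, so clearing [y] there is itself a
   truncation. *)
have xi_trunc m : exists m', trunc xi m = trunc y m'.
  elim: m => [|m [m' IH]]; first by exists 0%N; apply/funext.
  have [sm0|smn] := eqVneq (s m) 0.
    exists m'; rewrite -IH; apply/funext => k; rewrite /trunc ltnS.
    by case: ltngtP => // ->; rewrite /xi sm0 eqxx.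
  exists m.+1; apply/funext => k; rewrite /trunc; case: ifP => //; rewrite ltnS => km.
  by rewrite /xi ifF //; apply/negbTE; rewrite gt_eqF // (lt_le_trans _ (sm km)) // lt0r smn s0.
have Pxi m : Phi (trunc xi m) <= 1 by have [m' ->] := xi_trunc m.
have bP : has_ubound (range (fun n => Phi (trunc xi n))) by exists 1 => _ [m _ <-].
set th := snf_seq Phi xi.
have P_th m : Phi (trunc xi m) <= th by apply: ub_le_sup => //; exists m.
have upper m : \sum_(k < m) s k * xi k <= L * th.
  have := snf_holder snPhi eqPhi s0 sm m (c00_star_trunc m xi0 xim).
  rewrite (eq_bigr (fun k : 'I_m => s k * xi k)); last by move=> k _; rewrite /trunc ltn_ord.
  by move=> h; apply: (le_trans h); rewrite ler_wpM2l // ltW.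
(* The pairing is at most [L * th] by the Hölder inequality and comes arbitrarily close to [L]; as
   [L] is positive, [th] cannot be below 1. *)
have th1 : th = 1.
  apply/eqP; rewrite eq_le; apply/andP; split.
    by apply: ge_sup; [exists (Phi (trunc xi 0)), 0%N|move=> _ [m _ <-]].
  rewrite -(ler_pM2l Lp) mulr1; apply/ler_addgt0Pr => e e0.
  have [J hJ] := scvg _ (divr_gt0 e0 C0); rewrite ltr_pdivlMr // in hJ.
  have := upper J; rewrite sxi; have := yL J; lra.
exists xi; split=> //.
- split; first by move=> k sk; rewrite /xi sk eqxx.
  apply: (bounded_series_cvg (C := C)) => // n; apply: le_trans (yC n).
  by apply: ler_sum => k _; rewrite /xi; case: ifP.
- move=> e e0; have [J hJ] := scvg _ (divr_gt0 e0 C0); rewrite ltr_pdivlMr // in hJ.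
  exists J => n Jn; have := upper n; rewrite th1 mulr1 => h.
  rewrite ler0_norm ?subr_le0 // sxi.
  have h1 : s n * C <= s J * C by rewrite ler_wpM2r ?sm // ltW.
  have := yL n; lra.
Qed.

End NormingSequence.

Section Lorentz.
Variable R : realType.
Implicit Types (xi eta : R ^nat).

Section Weights.
Variables (w : R ^nat) (om : R).
Hypotheses (w1 : w 0%N = 1) (om0 : 0 < om) (w_om : forall k, om <= w k).
Hypothesis (wm : forall i j, (i <= j)%N -> w j <= w i).

Let lsum xi (t : seq nat) := \sum_(j < size t) w j * `|xi (nth 0%N t j)|.

(** For nonincreasing weights this is the usual weighted sum of the decreasing rearrangement. The
    supremum over duplicate-free lists of positions avoids sorting, and the triangle inequality
    holds list by list. *)
Definition lorentz xi : R := sup [set lsum xi t | t in [set t | uniq t]].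

Let w0 k : 0 <= w k := ltW (lt_le_trans om0 (w_om k)).

Lemma weighted_sum_le_max xi t n : uniq t -> (forall k, (n <= k)%N -> xi k = 0) ->
  lsum xi t <= \sum_(k < n) `|xi k|.
Proof.
move=> ut xi0; apply: (@le_trans _ _ (\sum_(i <- t) `|xi i|)).
  rewrite (big_nth 0%N) big_mkord; apply: ler_sum => j _.
  by rewrite ler_piMl // -w1 wm.
rewrite (bigID (fun i => i < n)%N) /= [X in _ + X]big1 ?addr0; last first.
  by move=> i; rewrite -leqNgt => /xi0 ->; rewrite normr0.
rewrite -(big_mkord xpredT (fun k => `|xi k|)) /index_iota subn0.
rewrite [leRHS](bigID (fun i => i \in t)) /= -[leLHS]addr0 lerD ?sumr_ge0 //.
rewrite -[leLHS]big_filter -[leRHS]big_filter le_eqVlt; apply/orP; left; apply/eqP.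
apply: perm_big; apply: uniq_perm; rewrite ?filter_uniq ?iota_uniq // => i.
by rewrite !mem_filter mem_iota /= add0n andbC.
Qed.

Lemma lorentz_ub xi : c00 xi -> has_ubound [set lsum xi t | t in [set t | uniq t]].
Proof.
move=> [n hn]; exists (\sum_(k < n) `|xi k|) => _ [t ut <-].
exact: weighted_sum_le_max.
Qed.

Lemma le_lorentz xi t : c00 xi -> uniq t -> lsum xi t <= lorentz xi.
Proof. by move=> cxi ut; apply: ub_le_sup; [exact: lorentz_ub|exists t]. Qed.

Lemma lorentz_le xi (C : R) :
  (forall t, uniq t -> lsum xi t <= C) -> lorentz xi <= C.
Proof.
move=> h; apply: ge_sup; first by exists (lsum xi [::]), [::].
by move=> _ [t ut <-]; exact: h.
Qed.

Lemma lorentz_ge_trunc xi n :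
  \sum_(k < n) w k * `|xi k| <= lorentz (trunc xi n).
Proof.
apply: le_trans (le_lorentz (c00_trunc xi n) (iota_uniq 0 n)).
rewrite /lsum size_iota le_eqVlt; apply/orP; left; apply/eqP.
by apply: eq_bigr => k _; rewrite nth_iota // add0n /trunc ltn_ord.
Qed.

Lemma lorentz_le_max xi n : lorentz (trunc xi n) <= \sum_(k < n) `|xi k|.
Proof.
apply: lorentz_le => t ut; apply: (le_trans (weighted_sum_le_max (n := n) ut _)).
  by move=> k nk; rewrite /trunc ltnNge nk.
by apply: ler_sum => k _; rewrite /trunc ltn_ord.
Qed.

Lemma lorentz_injective xi eta (p : nat -> nat) : c00 xi -> injective p ->
  (forall k, `|eta k| = `|xi (p k)|) -> lorentz eta <= lorentz xi.
Proof.
move=> cxi ip h; apply: lorentz_le => t ut.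
have utp : uniq (map p t) by rewrite map_inj_uniq.
apply: le_trans (le_lorentz cxi utp); rewrite /lsum size_map.
by apply: ler_sum => j _; rewrite (nth_map 0%N) // h.
Qed.

Lemma perm_nth_injective (u v : seq R) : perm_eq u v ->
  exists2 p : nat -> nat, injective p & forall k, nth 0 u k = nth 0 v (p k).
Proof.
move=> uv; have /(perm_iotaP 0) [Is pI uE] := uv.
have uI : uniq Is by rewrite (perm_uniq pI) iota_uniq.
have sI : size Is = size v by rewrite (perm_size pI) size_iota.
have mI k : (k < size Is)%N -> (nth 0%N Is k < size v)%N.
  by move=> kI; have := mem_nth 0%N kI; rewrite (perm_mem pI) mem_iota add0n.
(* The identity beyond the lists makes the map injective on all of [nat], while both sequences are
   zero there. *)
exists (fun k => if (k < size Is)%N then nth 0%N Is k else k).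
  move=> i j; case: ltnP => iI; case: ltnP => jI.
  - by move/eqP; rewrite nth_uniq // => /eqP.
  - by move=> ij; have := mI i iI; rewrite ij -sI ltnNge jI.
  - by move=> ij; have := mI j jI; rewrite -ij -sI ltnNge iI.
  - by [].
move=> k; rewrite uE; case: ltnP => kI; first by rewrite (nth_map 0%N).
by rewrite !nth_default ?size_map // -sI.
Qed.

Lemma c00_nth (u : seq R) : c00 (nth 0 u).
Proof. by exists (size u) => k uk; rewrite nth_default. Qed.

Lemma nth_map_norm (u : seq R) k : nth 0 [seq `|x| | x <- u] k = `|nth 0 u k|.
Proof.
have [ku|uk] := ltnP k (size u); first by rewrite (nth_map 0).
by rewrite !nth_default ?size_map ?normr0.
Qed.

Lemma lorentzD xi eta : c00 xi -> c00 eta ->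
  lorentz (fun k => xi k + eta k) <= lorentz xi + lorentz eta.
Proof.
move=> cxi ceta; apply: lorentz_le => t ut.
apply: le_trans (lerD (le_lorentz cxi ut) (le_lorentz ceta ut)).
rewrite /lsum -big_split; apply: ler_sum => j _.
by rewrite /= -mulrDr ler_wpM2l // ler_normD.
Qed.

Lemma lorentzZ_le (a : R) xi : c00 xi ->
  lorentz (fun k => a * xi k) <= `|a| * lorentz xi.
Proof.
move=> cxi; apply: lorentz_le => t ut.
apply: (@le_trans _ _ (`|a| * lsum xi t)); last by rewrite ler_wpM2l // le_lorentz.
rewrite /lsum mulr_sumr; apply: ler_sum => j _; rewrite normrM; lra.
Qed.

Lemma lorentz_snfunction : snfunction lorentz.
Proof.
split.
- move=> xi cxi; have := le_lorentz cxi (isT : uniq [::]).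
  by rewrite /lsum big_ord0.
- move=> xi cxi h; apply/funext => i; apply/normr0_eq0/eqP.
  rewrite eq_le normr_ge0 andbT -h.
  have := le_lorentz cxi (isT : uniq [:: i]).
  by rewrite /lsum big_ord1 w1 mul1r.
- move=> a xi cxi; apply/eqP; rewrite eq_le lorentzZ_le //=.
  have [->|a0] := eqVneq a 0.
    rewrite normr0 mul0r.
    have := le_lorentz (_ : c00 (fun k => 0 * xi k)) (isT : uniq [::]).
    by rewrite /lsum big_ord0; apply; exists 0%N => k _; rewrite mul0r.
  have ca : c00 (fun k => a * xi k).
    by have [n hn] := cxi; exists n => k /hn ->; rewrite mulr0.
  (* The reverse inequality is the one already proved, applied with the inverse scalar. *)
  have := lorentzZ_le a^-1 ca.
  rewrite (_ : (fun k => a^-1 * (a * xi k)) = xi); last first.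
    by apply/funext => k; rewrite mulKf.
  move=> h; apply: (le_trans (ler_wpM2l (normr_ge0 a) h)).
  by rewrite mulrA -normrM mulfV // normr1 mul1r.
- exact: lorentzD.
- apply/eqP; rewrite eq_le; apply/andP; split; last first.
    have := le_lorentz (c00_nth [:: 1]) (isT : uniq [:: 0%N]).
    by rewrite /lsum big_ord1 w1 mul1r /= normr1.
  apply: lorentz_le => t ut; apply: (le_trans (weighted_sum_le_max (n := 1) ut _)).
    by move=> [|[|k]].
  by rewrite big_ord1 /= normr1.
- move=> u v uv; apply/eqP; rewrite eq_le; apply/andP; split.
    rewrite perm_sym in uv; have [p ip hp] := perm_nth_injective uv.
    by apply: (lorentz_injective (c00_nth v) ip) => k; rewrite -hp nth_map_norm normr_id.
  have [p ip hp] := perm_nth_injective uv.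
  apply: (lorentz_injective (c00_nth u) ip) => k.
  by rewrite hp nth_map_norm normr_id.
Qed.

Lemma lorentz_equiv : snf_equiv lorentz (@snf_max R).
Proof.
split.
  exists 1 => _ [xi [/c00_truncE [n ->] _] <-].
  have [->|n0] := eqVneq (snf_max (trunc xi n)) 0; first by rewrite invr0 mulr0.
  have mp : 0 < snf_max (trunc xi n) by rewrite lt0r n0 snf_max_trunc sumr_ge0.
  by rewrite ler_pdivrMr // mul1r snf_max_trunc lorentz_le_max.
exists om^-1 => _ [xi [/c00_truncE [n ->] nz] <-].
have lp : 0 < lorentz (trunc xi n).
  rewrite lt0r (snf_ge0 lorentz_snfunction (c00_trunc xi n)) andbT.
  by apply/eqP => /(snf_eq0 lorentz_snfunction (c00_trunc xi n)).
rewrite ler_pdivrMr // mulrC ler_pdivlMr // snf_max_trunc.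
apply: le_trans (lorentz_ge_trunc xi n); rewrite mulr_suml.
by apply: ler_sum => k _; rewrite mulrC ler_wpM2r.
Qed.

Lemma lorentz_indicator n : lorentz (trunc (fun=> 1) n) <= \sum_(k < n) w k.
Proof.
apply: lorentz_le => t ut.
pose b j := (nth 0%N t j < n)%N.
pose c m := (\sum_(j < m) b j)%N.
have h m : (m <= size t)%N ->
    \sum_(j < m) w j * `|trunc (fun=> 1) n (nth 0%N t j)| <= \sum_(k < c m) w k.
  elim: m => [|m IH] mt; first by rewrite !big_ord0 sumr_ge0.
  have cm : (c m <= m)%N.
    rewrite -[leqRHS]card_ord -sum1_card; apply: leq_sum => j _; exact: leq_b1.
  have -> : c m.+1 = (c m + b m)%N by rewrite /c big_ord_recr.
  rewrite big_ord_recr /= {2}/trunc -/(b m); case: (b m).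
    by rewrite addn1 big_ord_recr /= normr1 mulr1 lerD ?wm // IH // ltnW.
  by rewrite normr0 mulr0 addr0 addn0 IH // ltnW.
apply: (le_trans (h _ (leqnn _))).
have cn : (c (size t) <= n)%N.
  rewrite /c -(big_mkord xpredT (fun j => nat_of_bool (b j))).
  rewrite -(big_nth 0%N xpredT (fun i => nat_of_bool (i < n)%N)).
  rewrite (_ : (\sum_(i <- t) _)%N = count (fun i => i < n)%N t); last first.
    by rewrite -sum1_count [RHS]big_mkcond; apply: eq_bigr => i _; case: (_ < _)%N.
  rewrite -size_filter -[leqRHS](size_iota 0 n); apply: uniq_leq_size.
    by rewrite filter_uniq.
  by move=> i; rewrite mem_filter mem_iota => /andP[].
rewrite (big_ord_widen n w cn) big_mkcond /=; apply: ler_sum => k _.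
by case: ifP.
Qed.

End Weights.
End Lorentz.

(** * Norming operators *)

Section NormingOperators.
Variables (R : realType) (H : completeNormedModType R[i]).
Variable dot : {dot H for Num.conj}.
Hypothesis norm_dot : forall x : H, `|x| ^+ 2 = dot x x.
Hypotheses (sH : @separable_space R H) (iH : infinite_dimensional H).
Implicit Types (T K : H -> H) (Phi : R ^nat -> R).

Lemma schmidt_trace_class K s e f : bounded_operator K ->
  schmidt_expansion dot K s e f -> cvgn (series s) -> trace_class K.
Proof. by move=> bK sch cs; split=> //; rewrite (schmidt_snum norm_dot bK sch). Qed.

Lemma compact_adj_norming T Phi : compact_operator T ->
  snfunction Phi -> snf_equiv Phi (@snf_max R) -> adj_norming dot Phi T.
Proof.
move=> cT snPhi eqPhi; have bT := cT.1.
have [s [e [f sch]]] := schmidt_exists norm_dot cT.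
have sE := schmidt_snum norm_dot bT sch.
have s0 := sch_ge0 sch; have sm := sch_mono sch.
have L_ge0 : s 0%N <= snf_seq (snf_adjoint Phi) s.
  apply: le_trans (snf_seq_adjoint_ge snPhi eqPhi s0 sm 1).
  have := snf_adjoint_ge snPhi eqPhi s0 sm 1 (delta_c00_star R) (snf1 snPhi).
  by rewrite big_ord1 /= mulr1.
rewrite /adj_norming snf_normE sE.
have [s00|s00] := eqVneq (s 0%N) 0.
  have T0 x : T x = 0.
    apply/nrm_eq0/eqP; rewrite eq_le nrm_ge0 andbT.
    by rewrite -(mul0r (nrm x)) -s00 (sch_le sch).
  have sz j : s j = 0 by apply/eqP; rewrite eq_le s0 andbT -s00 sm.
  have L0 : snf_seq (snf_adjoint Phi) s = 0.
    apply/eqP; rewrite eq_le; apply/andP; split; last by rewrite -s00.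
    apply: ge_sup; first by exists (snf_adjoint Phi (trunc s 0)), 0%N.
    move=> _ [n _ <-]; apply: (snf_adjoint_le snPhi) => xi _ _.
    by rewrite big1 // => k _; rewrite sz mul0r.
  have [u u1] := unit_vector iH.
  (* For [T = 0] the dual norm is zero and any [K] of norm one will do: here the orthogonal
     projection on the line of a unit vector. *)
  pose k : R ^nat := nth 0 [:: 1]; pose g j : H := if j == 0%N then u else 0.
  have og n : orthosys dot n g.
    split=> [i j _ _|i _]; last by rewrite /g; case: eqP; [right|left].
    by rewrite /g; case: eqP => [->|_]; case: eqP => [->|_] //; rewrite ?dot0l ?dot0r.
  have cs : cvgn (series k).
    apply: (bounded_series_cvg (C := 1)) => [[|[|j]] //=|[|n]].
      by rewrite big_ord0.
    by rewrite big_ord_recl big1 ?addr0 // => j _; rewrite /k /= nth_nil.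
  have [k0|||K bK schK] := schmidt_operator norm_dot og og _ _ _ cs.
  - by case: k0 => [|[|j]] /=.
  - by move=> [|[|m]] [|[|n]] //=.
  - by move=> [|[|j]]; rewrite /k /g /= ?eqxx.
  exists K; split; first exact: schmidt_trace_class schK cs.
    rewrite snf_normE (schmidt_snum norm_dot bK schK).
    have Pk n : Phi (trunc k n.+1) = 1.
      rewrite -(snf1 snPhi); congr Phi; apply/funext => j.
      by rewrite /trunc /k; case: j => [//|j]; rewrite nth_default // if_same.
    apply/eqP; rewrite eq_le; apply/andP; split.
      apply: ge_sup; first by exists (Phi (trunc k 0)), 0%N.
      move=> _ [[|n] _ <-]; last by rewrite Pk.
      by rewrite (_ : trunc k 0 = fun=> 0) ?(snf0 snPhi) //; apply/funext.
    rewrite -(Pk 0%N); apply: ub_le_sup; last by exists 1%N.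
    exists 1 => _ [[|n] _ <-]; last by rewrite Pk.
    by rewrite (_ : trunc k 0 = fun=> 0) ?(snf0 snPhi) //; apply/funext.
  rewrite L0 (@trace_eq _ _ _ norm_dot _ 0) ?normr0 //.
  apply: (schmidt_has_trace norm_dot bT bK schK cs).
  apply/(@cvg_seqP R (R[i] : numFieldType)) => r r0; exists 0%N => n _.
  by rewrite big1 ?subrr ?nrm0 // => j _; rewrite T0 dot0l mulr0.
have sp : 0 < s 0%N by rewrite lt0r s00 s0.
have [xi [xi0 xim [xis cs] Pxi xiL]] :=
  norming_sequence snPhi eqPhi s0 sm sp (schmidt_cvg0 norm_dot cT sch).
(* The two systems trade places, so that [K] sends [f j] to a multiple of [e j] and [T \o K] is
   diagonal on the [f j]. *)
have [|K bK schK] := schmidt_operator norm_dot (sch_f sch) (sch_e sch) xi0 xim _ cs.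
  move=> j xij; have [|-> ->//] := sch_unit sch (j := j) _.
  by apply: contra_neq xij; exact: xis.
exists K; split; first exact: schmidt_trace_class schK cs.
  by rewrite snf_normE (schmidt_snum norm_dot bK schK).
rewrite (@trace_eq _ _ _ norm_dot _ (snf_seq (snf_adjoint Phi) s)%:C) //.
  by rewrite nrmE nrm_real ger0_norm // (le_trans (s0 0%N)).
apply: (schmidt_has_trace norm_dot bT bK schK cs).
apply/(@cvg_seqP R (R[i] : numFieldType)) => r r0.
have [N hN] := xiL _ (divr_gt0 r0 (ltr0n R 2)); exists N => n /hN h.
have -> : \sum_(j < n) (xi j)%:C * dot (T (e j)) (f j) =
    (\sum_(j < n) s j * xi j)%:C.
  rewrite rmorph_sum; apply: eq_bigr => j _.
  rewrite (sch_apply sch) dotZl (dotxx norm_dot) -!rmorphM /=; congr _%:C.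
  have [->|/(sch_unit sch) [_ ->]] := eqVneq (s j) 0; first by rewrite !mul0r mulr0.
  by rewrite expr1n mulr1 mulrC.
rewrite -rmorphB /= nrm_real; apply: (le_lt_trans h).
by rewrite ltr_pdivrMr // ltr_pMr // ltr1n.
Qed.

Lemma geometric_le2 n : \sum_(k < n) (2^-1 : R) ^+ k <= 2.
Proof.
suff -> : \sum_(k < n) (2^-1 : R) ^+ k = 2 - 2 * 2^-1 ^+ n.
  by rewrite lerBlDr lerDl mulr_ge0 // exprn_ge0 // invr_ge0.
elim: n => [|n IH]; first by rewrite big_ord0 expr0; ring.
by rewrite big_ord_recr /= IH exprS; field.
Qed.

Section NonCompact.
Variables (T : H -> H) (d : R).
Hypotheses (bT : bounded_operator T) (d0 : 0 < d) (dT : forall j, d <= snum T j).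

Let s := snum T.
Let al := s 0%N + 1.
(* Chosen so that [al * w] exceeds [s] termwise while the averages of [al * w]
   and [s] have the same limit. *)
Let w k := (s k + 2^-1 ^+ k) / al.

Let s0 k : 0 <= s k. Proof. exact: snum_ge0. Qed.
Let sm i j : (i <= j)%N -> s j <= s i. Proof. exact: snum_nonincreasing. Qed.
Let alp : 0 < al. Proof. by rewrite /al ltr_wpDl. Qed.
Let w1 : w 0%N = 1. Proof. by rewrite /w expr0 divff // gt_eqF. Qed.
Let om0 : 0 < d / al. Proof. by rewrite divr_gt0. Qed.

Let w_om k : d / al <= w k.
Proof.
rewrite ler_wpM2r ?invr_ge0 ?(ltW alp) //; apply: (le_trans (dT k)).
by rewrite lerDl exprn_ge0 // invr_ge0.
Qed.

Let wm i j : (i <= j)%N -> w j <= w i.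
Proof.
move=> ij; rewrite ler_wpM2r ?invr_ge0 ?(ltW alp) // lerD ?sm //.
by rewrite ler_wiXn2l // ?invr_ge0 // invf_le1 // ler1n.
Qed.

Lemma noncompact_snfunction : snfunction (lorentz w).
Proof. exact: lorentz_snfunction w1 om0 w_om wm. Qed.

Lemma noncompact_equiv : snf_equiv (lorentz w) (@snf_max R).
Proof. exact: lorentz_equiv w1 om0 w_om wm. Qed.

Let snw := noncompact_snfunction.
Let eqw := noncompact_equiv.

Let L := snf_seq (snf_adjoint (lorentz w)) s.

Lemma noncompact_norm_ge : al <= L.
Proof.
have L0 : 0 <= L.
  apply: le_trans (s0 0%N) _.
  apply: le_trans (snf_seq_adjoint_ge snw eqw s0 sm 1).
  have := snf_adjoint_ge snw eqw s0 sm 1 (delta_c00_star R) (snf1 snw).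
  by rewrite big_ord1 /= mulr1.
rewrite leNgt; apply/negP => Lal.
(* With [S] the [n]-th partial sum of [s], testing on the indicator gives [al * S <= L * (S + 2)],
   the 2 coming from the geometric series; moreover [S] is at least [n * d]. Large [n] then
   contradicts [L < al]. *)
have key n : (al - L) * (n%:R * d) <= 2 * L.
  have h1 : \sum_(k < n) s k <= L * lorentz w (trunc (fun=> 1) n).
    have := snf_holder snw eqw s0 sm n (c00_star_trunc (s := fun=> 1) n (fun=> ler01) (fun _ _ _ => lexx 1)).
    rewrite (eq_bigr (fun k : 'I_n => s k)) // => k _.
    by rewrite /trunc ltn_ord mulr1.
  have h2 : lorentz w (trunc (fun=> 1) n) <= (\sum_(k < n) s k + 2) / al.
    apply: (le_trans (lorentz_indicator om0 w_om wm n)).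
    rewrite -mulr_suml ler_wpM2r ?invr_ge0 ?(ltW alp) // big_split /= lerD2l.
    exact: geometric_le2.
  have h3 : n%:R * d <= \sum_(k < n) s k.
    rewrite mulr_natl -[n in _ *+ n]card_ord -sumr_const.
    by apply: ler_sum => k _; exact: dT.
  have h4 : (\sum_(k < n) s k) * al <= L * (\sum_(k < n) s k + 2).
    by rewrite -ler_pdivlMr // -mulrA; exact: le_trans h1 (ler_wpM2l L0 h2).
  have : (al - L) * (n%:R * d) <= (al - L) * \sum_(k < n) s k.
    by rewrite ler_wpM2l // subr_ge0 ltW.
  move: h4; lra.
have cp : 0 < (al - L) * d by rewrite mulr_gt0 // subr_gt0.
have q0 : 0 <= 2 * L / ((al - L) * d) by rewrite divr_ge0 ?(ltW cp) // mulr_ge0.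
have := archi_boundP q0; rewrite ltr_pdivrMr // => h.
have := key (Num.bound (2 * L / ((al - L) * d))).
by rewrite mulrCA leNgt h.
Qed.

Lemma noncompact_not_norming : ~ adj_norming dot (lorentz w) T.
Proof.
move=> [K [[bK cK] Kn trK]].
have cpK : compact_operator K.
  apply: (approximable_compact norm_dot bK) => r r0.
  have r2 : 0 < r / 2 by rewrite divr_gt0.
  have [N hN] := summable_cvg0 (snum_ge0 bK) cK (snum_nonincreasing bK) r2.
  exists N; apply: (le_lt_trans (hN N (leqnn N))).
  by rewrite ltr_pdivrMr // ltr_pMr // ltr1n.
have [k [e [f sch]]] := schmidt_exists norm_dot cpK.
have kE := schmidt_snum norm_dot bK sch; rewrite kE in cK.
rewrite snf_normE kE in Kn.
have k0 := sch_ge0 sch; have km := sch_mono sch.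
have [t ht] := schmidt_trace_ex norm_dot iH bT sch cK.
have tE := trace_eq norm_dot sH iH (schmidt_has_trace norm_dot bT bK sch cK ht).
have [B hB] : exists B, forall n, \sum_(j < n) k j <= B.
  by have [N hN] := series_tail k0 cK ltr01; exists (\sum_(j < N) k j + 1).
have wk n : \sum_(j < n) w j * k j <= 1.
  rewrite -[leRHS]Kn; apply: (@le_trans _ _ (lorentz w (trunc k n))).
    apply: le_trans (lorentz_ge_trunc w1 wm k n).
    by apply: ler_sum => j _; rewrite ger0_norm.
  apply: ub_le_sup; last by exists n.
  exists B => _ [m _ <-]; apply: (le_trans (lorentz_le_max w1 wm k m)).
  apply: le_trans (hB m); apply: ler_sum => j _; by rewrite ger0_norm.
have k0p : 0 < k 0%N.
  rewrite lt0r k0 andbT; apply/eqP => k00.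
  have kz j : k j = 0 by apply/eqP; rewrite eq_le k0 andbT -k00 km.
  have : snf_seq (lorentz w) k <= 0.
    apply: ge_sup; first by exists (lorentz w (trunc k 0)), 0%N.
    move=> _ [n _ <-]; rewrite (_ : trunc k n = fun=> 0) ?(snf0 snw) //.
    by apply/funext => j; rewrite /trunc kz if_same.
  by rewrite Kn ler10.
have bound : nrm t <= al - k 0%N.
  (* Starting at [n = 1] places [k 0] in the subtracted sum below, where it is the one term
     retained; it makes the bound strict. *)
  apply: (@nrm_cvg_le _ (R[i] : numFieldType) _ _ _ 1%N ht) => n n1.
  apply: (@le_trans _ _ (\sum_(j < n) k j * s j)).
    apply: (@abel_le _ k s (fun j => dot (T (f j)) (e j))) => [//|j|m _].
      exact: km.
    exact: (ky_fan norm_dot bT (sch_e sch m) (sch_f sch m)).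
  have -> : \sum_(j < n) k j * s j =
      al * (\sum_(j < n) w j * k j) - \sum_(j < n) 2^-1 ^+ j * k j.
    rewrite mulr_sumr -sumrB; apply: eq_bigr => j _.
    by rewrite /w; field; rewrite gt_eqF.
  rewrite lerB //; first by rewrite ler_piMr ?(ltW alp).
  case: n n1 => // n _; rewrite big_ord_recl expr0 mul1r lerDl sumr_ge0 // => j _.
  by rewrite mulr_ge0 // exprn_ge0 // invr_ge0.
move: trK; rewrite tE nrmE snf_normE -/s -/L => /complexI tL.
have := noncompact_norm_ge; rewrite -tL; move: bound k0p; lra.
Qed.

End NonCompact.

Lemma adj_norming_compact T : bounded_operator T ->
  (forall Phi, snfunction Phi -> snf_equiv Phi (@snf_max R) ->
     adj_norming dot Phi T) -> compact_operator T.
Proof.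
move=> bT h; apply: contrapT => ncT.
have [d d0 dT] : exists2 d : R, 0 < d & forall j, d <= snum T j.
  apply: contrapT => hN; apply: ncT; apply: (approximable_compact norm_dot bT).
  move=> r r0; apply: contrapT => /forallNP hj; apply: hN; exists r => // j.
  by rewrite leNgt; apply/negP/hj.
apply: (noncompact_not_norming bT d0 dT); apply: h.
  exact: (noncompact_snfunction bT d0 dT).
exact: (noncompact_equiv bT d0 dT).
Qed.

End NormingOperators.

Theorem theorem5p6 (R : realType) (H : completeNormedModType R[i])
    (dot : {dot H for Num.conj})
    (norm_dot : forall x : H, `|x| ^+ 2 = dot x x)
    (H_separable : separable_space H)
    (H_infinite : infinite_dimensional H)
    (T : H -> H) (T_bounded : bounded_operator T) :
  [<-> compact_operator T;
       forall Phi : R ^nat -> R,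
         snfunction Phi -> snf_equiv Phi (@snf_max R) ->
         abs_adj_norming dot Phi T;
       forall Phi : R ^nat -> R,
         snfunction Phi -> snf_equiv Phi (@snf_max R) ->
         adj_norming dot Phi T].
Proof.
tfae=> [cT Phi snPhi eqPhi M cM _|h Phi snPhi eqPhi|].
- apply: (compact_adj_norming norm_dot H_separable H_infinite) => //.
  exact: (compact_comp_proj norm_dot).
(* The whole space is an admissible subspace, nonzero because [H] contains a unit vector. *)
- have TE : T \o Defs.proj dot [set: H] = T.
    by apply/funext => x; rewrite /= (projT norm_dot).
  rewrite -TE; apply: (h Phi snPhi eqPhi [set: H]); first by split.
  have [u u1] := unit_vector H_infinite => ST.
  have : [set: H] u by []; rewrite ST => u0.
  by move: u1; rewrite u0 nrm0 => /esym/eqP; rewrite oner_eq0.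
- exact: (adj_norming_compact norm_dot H_separable H_infinite).
Qed.
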